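(* Let $(M,g)$ be a Riemannian manifold, let $T(M)$ be equipped with the metric $g_A$ described in the context, and let $(p,\mathtt{u})\in T(M)$. If $X,Y\in T_pM$ are two orthonormal vectors, then the sectional curvatures of $g_A$ at $(p,\mathtt{u})$ are $$\tilde K^A(X^H,Y^H)=K(X,Y)-\frac{3a(t)}4\left|R_{XY}\mathtt{u}\right|^2,$$ $$\tilde K^A(X^H,Y^V)=\frac{a(t)^2}{4\left(a(t)+b(t)g(Y,\mathtt{u})^2\right)}\left|R_{\mathtt{u}Y}X\right|^2,$$ $$\tilde K^A(X^V,Y^V)=-\frac{F_1(t)a(t)g(Y,\mathtt{u})^2+F_2(t)\left(a(t)+b(t)g(X,\mathtt{u})^2\right)+F_3(t)(a(t)+2tb(t))g(X,\mathtt{u})^2}{a(t)^2+a(t)b(t)\left(g(X,\mathtt{u})^2+g(Y,\mathtt{u})^2\right)},$$ where $K(X,Y)$ is the sectional curvature of the plane of $T_pM$ spanned by $X$ and $Y$.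
   Context: $t=\frac12 g_p(\mathtt{u},\mathtt{u})$; $X^H,X^V$ are the horizontal (with respect to the Levi-Civita connection $\nabla$ of $g$) and vertical lifts to $T_{(p,\mathtt{u})}T(M)$; $|\cdot|$ is the norm of $g$; $R_{XY}=\nabla_X\nabla_Y-\nabla_Y\nabla_X-\nabla_{[X,Y]}$. The functions $a,b:[0,+\infty)\to[0,+\infty)$ are smooth with $a>0$, and $$g_A(X^H,Y^H)=g(X,Y),\quad g_A(X^H,Y^V)=0,\quad g_A(X^V,Y^V)=a(t)g(X,Y)+b(t)g(X,\mathtt{u})g(Y,\mathtt{u}).$$ With $\mathtt{L}=\frac{a'}{2a}$, $\mathtt{M}=\frac{2b-a'}{2(a+2tb)}$, $\mathtt{N}=\frac{ab'-2a'b}{2a(a+2tb)}$ (functions of $t$, primes denote $d/dt$), put $F_1=\mathtt{L}'-\mathtt{L}^2-\mathtt{N}(1+2t\mathtt{L})$, $F_2=\mathtt{L}-\mathtt{M}(1+2t\mathtt{L})$, $F_3=\mathtt{N}-(\mathtt{M}'+\mathtt{M}^2+2t\mathtt{M}\mathtt{N})$. The sectional curvature is $$\tilde K^A(U,V)=\frac{g_A(\tilde R^A_{UV}V,U)}{g_A(U,U)g_A(V,V)-g_A(U,V)^2},$$ where $\tilde R^A$ is the curvature tensor of $g_A$ (same sign convention as $R$). *)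

(* Defs.v *)
From mathcomp Require Import all_boot all_order all_algebra.
From mathcomp Require Import all_classical all_reals all_analysis.
From mathcomp Require Import ring lra.

Set Implicit Arguments.
Unset Strict Implicit.
Unset Printing Implicit Defensive.

Import Order.TTheory GRing.Theory Num.Theory.
Import numFieldNormedType.Exports.

Local Open Scope classical_set_scope.
Local Open Scope ring_scope.

Section Smooth.
Context {R : realType}.

Definition iter_derive {n : nat} {W : normedModType R}
    (s : seq 'rV[R]_n) (f : 'rV[R]_n -> W) : 'rV[R]_n -> W :=
  foldr (fun v h x => 'D_v h x) f s.

(* [f] is C^infinity on the open set [O]; its values off [O] are irrelevant. *)
Definition smooth_on {n : nat} {W : normedModType R}
    (O : set 'rV[R]_n) (f : 'rV[R]_n -> W) : Prop :=
  forall (s : seq 'rV[R]_n) x, O x -> differentiable (iter_derive s f) x.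

(* Calculus on [0, +oo[: the derivative at [t >= 0] is the limit of the
   difference quotients at points of [0, +oo[, hence the usual derivative for
   [t > 0] and the right derivative for [t = 0].  The values of [f] at negative
   reals play no role. *)
Definition hl_quotient (f : R -> R) (t s : R) : R := (f s - f t) / (s - t).

Definition hl_filter (t : R) : set_system R := within [set s | 0 <= s] t^'.

Definition hl_derive (f : R -> R) (t : R) : R :=
  lim (hl_quotient f t @ hl_filter t).

Definition hl_smooth (f : R -> R) : Prop :=
  forall (k : nat) (t : R), 0 <= t ->
    cvg (hl_quotient (iter k hl_derive f) t @ hl_filter t).

End Smooth.

(* Riemannian geometry of a field [G] of Gram matrices on (an open subset of)
   R^m.  Vector fields are functions ['rV_m -> 'rV_m]. *)
Section LocalGeometry.
Context {R : realType} {m : nat}.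
Implicit Types (G : 'rV[R]_m -> 'M[R]_m) (x v w z : 'rV[R]_m).

Definition inner G x v w : R := (v *m G x *m w^T) 0 0.

Definition partial (k : 'I_m) (f : 'rV[R]_m -> R) x : R :=
  'D_(delta_mx 0 k : 'rV[R]_m) f x.

Definition christoffel G (k i j : 'I_m) x : R :=
  2^-1 * \sum_(l < m) invmx (G x) k l *
    (partial i (fun y => G y j l) x + partial j (fun y => G y i l) x
     - partial l (fun y => G y i j) x).

Definition christoffel_form G x v w : 'rV[R]_m :=
  \row_k \sum_(i < m) \sum_(j < m) v 0 i * w 0 j * christoffel G k i j x.

(* The Levi-Civita connection; see [nabla_torsion_free], [nabla_metric] and
   [christoffel_unique]. *)
Definition nabla G (V W : 'rV[R]_m -> 'rV[R]_m) : 'rV[R]_m -> 'rV[R]_m :=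
  fun x => 'D_(V x) W x + christoffel_form G x (V x) (W x).

Definition bracket (V W : 'rV[R]_m -> 'rV[R]_m) : 'rV[R]_m -> 'rV[R]_m :=
  fun x => 'D_(V x) W x - 'D_(W x) V x.

Definition curvature_op G (V W Z : 'rV[R]_m -> 'rV[R]_m) :
    'rV[R]_m -> 'rV[R]_m :=
  fun x => nabla G V (nabla G W Z) x - nabla G W (nabla G V Z) x
           - nabla G (bracket V W) Z x.

(* By tensoriality, any extension of the vectors [v], [w], [z] at [x] to vector
   fields may be used. *)
Definition curvature G x v w z : 'rV[R]_m :=
  curvature_op G (cst v) (cst w) (cst z) x.

Definition sectional G x v w : R :=
  inner G x (curvature G x v w w) v
  / (inner G x v v * inner G x w w - inner G x v w ^+ 2).

End LocalGeometry.

Section LeviCivita.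
Context {R : realType} {m : nat}.
Variables (G : 'rV[R]_m -> 'M[R]_m) (x : 'rV[R]_m).
Hypothesis G_sym : \forall y \near x, (G y)^T = G y.
Hypothesis G_unit : G x \in unitmx.

Lemma innerE y v w :
  inner G y v w = \sum_i \sum_j v 0 i * G y i j * w 0 j.
Proof.
rewrite /inner mxE exchange_big; apply: eq_bigr => j _ /=.
by rewrite !mxE big_distrl.
Qed.

Lemma gram_sym i j : G x i j = G x j i.
Proof. by rewrite -[in LHS](nbhs_singleton G_sym) mxE. Qed.

Lemma partial_gram_sym k i j :
  partial k (fun y => G y i j) x = partial k (fun y => G y j i) x.
Proof.
apply: near_eq_derive; apply: filterS G_sym => y Gy.
by rewrite -[in LHS]Gy mxE.
Qed.

Lemma christoffel_sym k i j : christoffel G k i j x = christoffel G k j i x.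
Proof.
congr (_ * _); apply: eq_bigr => l _; congr (_ * _).
by rewrite (partial_gram_sym l i j) [X in X - _]addrC.
Qed.

Lemma christoffel_lower i j l :
  \sum_k christoffel G k i j x * G x k l =
  2^-1 * (partial i (fun y => G y j l) x + partial j (fun y => G y i l) x
          - partial l (fun y => G y i j) x).
Proof.
under eq_bigr do rewrite /christoffel -mulrA.
rewrite -big_distrr /=; congr (_ * _).
under eq_bigr do rewrite big_distrl /=.
rewrite exchange_big /= (bigD1 l) //= [X in _ + X]big1 ?addr0.
  under eq_bigr => k _ do rewrite mulrAC [invmx _ _ _ * _]mulrC gram_sym.
  rewrite -big_distrl /=.
  have := congr1 (fun A : 'M[R]_m => A l l) (mulmxV G_unit).
  by rewrite !mxE eqxx /= => ->; rewrite mul1r.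
move=> r rl.
under eq_bigr => k _ do rewrite mulrAC [invmx _ _ _ * _]mulrC gram_sym.
rewrite -big_distrl /=.
have := congr1 (fun A : 'M[R]_m => A l r) (mulmxV G_unit).
by rewrite !mxE eq_sym (negPf rl) /= => ->; rewrite mul0r.
Qed.

Lemma christoffel_metric k i j :
  partial k (fun y => G y i j) x =
  \sum_l (christoffel G l k i x * G x l j + christoffel G l k j x * G x l i).
Proof.
rewrite big_split /= !christoffel_lower.
rewrite (partial_gram_sym k j i).
by rewrite -mulrDr; field.
Qed.

Lemma christoffel_unique (c : 'I_m -> 'I_m -> 'I_m -> R) :
    (forall k i j, c k i j = c k j i) ->
    (forall k i j, partial k (fun y => G y i j) x =
       \sum_l (c l k i * G x l j + c l k j * G x l i)) ->
  forall k i j, c k i j = christoffel G k i j x.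
Proof.
move=> c_sym c_metric k i j.
have E l : partial i (fun y => G y j l) x + partial j (fun y => G y i l) x
    - partial l (fun y => G y i j) x = 2 * \sum_r c r i j * G x r l.
  have S p q s : \sum_r c r p q * G x r s = \sum_r c r q p * G x r s.
    by apply: eq_bigr => r _; rewrite c_sym.
  by rewrite !c_metric !big_split /= (S j i) (S l i) (S l j); ring.
rewrite /christoffel; under eq_bigr do rewrite E mulrCA.
rewrite -big_distrr /= mulrA mulVf ?pnatr_eq0 // mul1r.
under eq_bigr do rewrite big_distrr /=.
rewrite exchange_big /= (bigD1 k) //= [X in _ + X]big1 ?addr0.
  under eq_bigr => l _ do rewrite mulrCA gram_sym.
  rewrite -big_distrr /=.
  have := congr1 (fun A : 'M[R]_m => A k k) (mulVmx G_unit).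
  by rewrite !mxE eqxx /= => ->; rewrite mulr1.
move=> r rk.
under eq_bigr => l _ do rewrite mulrCA gram_sym.
rewrite -big_distrr /=.
have := congr1 (fun A : 'M[R]_m => A k r) (mulVmx G_unit).
by rewrite !mxE eq_sym (negPf rk) /= => ->; rewrite mulr0.
Qed.

Lemma nabla_torsion_free (V W : 'rV[R]_m -> 'rV[R]_m) :
  nabla G V W x - nabla G W V x = bracket V W x.
Proof.
rewrite /nabla /bracket.
suff -> : christoffel_form G x (V x) (W x) = christoffel_form G x (W x) (V x).
  by rewrite opprD addrACA subrr addr0.
apply/rowP => k; rewrite !mxE exchange_big /=.
apply: eq_bigr => i _; apply: eq_bigr => j _.
by rewrite christoffel_sym [V x 0 j * _]mulrC.
Qed.

Lemma derive_partial (f : 'rV[R]_m -> R) (v : 'rV[R]_m) : differentiable f x ->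
  'D_v f x = \sum_k v 0 k * partial k f x.
Proof.
move=> df; rewrite deriveE // {1}[v]row_sum_delta linear_sum /=.
by apply: eq_bigr => k _; rewrite linearZ /partial deriveE.
Qed.

Lemma nabla_metric (V W Z : 'rV[R]_m -> 'rV[R]_m) :
    differentiable G x -> differentiable W x -> differentiable Z x ->
  'D_(V x) (fun y => inner G y (W y) (Z y)) x =
  inner G x (nabla G V W x) (Z x) + inner G x (W x) (nabla G V Z x).
Proof.
move=> dG dW dZ; set v := V x.
have dcW k : differentiable (fun y => W y 0 k) x.
  exact: (differentiable_comp dW (differentiable_coord _ _ _)).
have dcZ k : differentiable (fun y => Z y 0 k) x.
  exact: (differentiable_comp dZ (differentiable_coord _ _ _)).
have dcG i j : differentiable (fun y => G y i j) x.
  exact: (differentiable_comp dG (differentiable_coord _ _ _)).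
have -> : (fun y => inner G y (W y) (Z y)) =
    \sum_i \sum_j ((fun y => W y 0 i) * (fun y => G y i j) * (fun y => Z y 0 j)).
  by apply/funext => y; rewrite innerE !fct_sumE; apply: eq_bigr => i _;
     rewrite fct_sumE.
have dP i j : derivable ((fun y => W y 0 i) * (fun y => G y i j) *
    (fun y => Z y 0 j)) x v.
  by apply: derivableM; [apply: derivableM|]; exact: diff_derivable.
rewrite derive_sum; last by move=> i; exact: derivable_sum.
under eq_bigr => i _ do rewrite derive_sum //.
have DWE i : 'D_v W x 0 i = 'D_v (fun y => W y 0 i) x.
  by rewrite derive_mx ?mxE //; exact: diff_derivable.
have DZE i : 'D_v Z x 0 i = 'D_v (fun y => Z y 0 i) x.
  by rewrite derive_mx ?mxE //; exact: diff_derivable.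
have -> : \sum_i \sum_j 'D_v ((fun y => W y 0 i) * (fun y => G y i j) *
      (fun y => Z y 0 j)) x =
    inner G x ('D_v W x) (Z x) + inner G x (W x) ('D_v Z x) +
    \sum_i \sum_j W x 0 i * Z x 0 j * 'D_v (fun y => G y i j) x.
  rewrite !innerE -!big_split /=; apply: eq_bigr => i _.
  rewrite -!big_split /=; apply: eq_bigr => j _.
  rewrite !deriveM; do ?[exact: diff_derivable | apply: derivableM].
  rewrite DWE DZE mulrfctE; set p := (derive _ _ _); set q := (derive _ _ _).
  by set r := (derive _ _ _); rewrite /GRing.scale /=; ring.
have inner_Dl a b c : inner G x (a + b) c = inner G x a c + inner G x b c.
  by rewrite /inner !mulmxDl mxE.
have inner_Dr a b c : inner G x c (a + b) = inner G x c a + inner G x c b.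
  by rewrite /inner linearD mulmxDr mxE.
have inner_sym a b : inner G x a b = inner G x b a.
  rewrite !innerE exchange_big; apply: eq_bigr => i _; apply: eq_bigr => j _.
  by rewrite gram_sym; ring.
have inner_form w z : inner G x (christoffel_form G x v w) z =
    \sum_i \sum_j w 0 i * z 0 j *
      \sum_k v 0 k * \sum_l christoffel G l k i x * G x l j.
  rewrite innerE exchange_big /= [RHS]exchange_big /=; apply: eq_bigr => j _.
  under eq_bigr => l _.
    rewrite !mxE exchange_big !big_distrl /=.
    under eq_bigr => i _ do rewrite !big_distrl /=.
    over.
  rewrite exchange_big /=; apply: eq_bigr => i _.
  rewrite exchange_big big_distrr /=; apply: eq_bigr => k _.
  rewrite !big_distrr /=; apply: eq_bigr => l _.
  by ring.
rewrite /nabla -/v inner_Dl inner_Dr [inner G x (W x) (christoffel_form _ _ _ _)]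
  inner_sym !inner_form addrACA; congr (_ + _).
rewrite [X in _ = _ + X]exchange_big -big_split /=; apply: eq_bigr => i _.
rewrite -big_split /=; apply: eq_bigr => j _.
rewrite derive_partial // [Z x 0 j * _]mulrC -mulrDr -big_split /=; congr (_ * _).
apply: eq_bigr => k _; rewrite -mulrDr christoffel_metric big_split /=.
by [].
Qed.

End LeviCivita.

(* A set with charts into R^n.  [transition i j] is a function whose values
   matter only on the image under [coord i] of the overlap of the charts [i]
   and [j]. *)
Record atlas (R : realType) (n : nat) := Atlas {
  point :> Type;
  chart : Type;
  dom : chart -> set point;
  coord : chart -> point -> 'rV[R]_n;
  transition : chart -> chart -> 'rV[R]_n -> 'rV[R]_n }.

Definition atlas_open {R : realType} {n : nat} (A : atlas R n) (U : set A) :=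
  forall i : chart A, open (coord i @` (dom i `&` U)).

Record is_manifold {R : realType} {n : nat} (A : atlas R n) : Prop :=
  IsManifold {
  dom_cover : forall p : A, exists i, dom i p;
  coord_inj : forall (i : chart A) p q,
    dom i p -> dom i q -> coord i p = coord i q -> p = q;
  coord_dom_open : forall i : chart A, open (coord i @` dom i);
  coord_overlap_open : forall i j : chart A,
    open (coord i @` (dom i `&` dom j));
  transitionE : forall (i j : chart A) p,
    dom i p -> dom j p -> coord j p = transition i j (coord i p);
  transition_smooth : forall i j : chart A,
    smooth_on (coord i @` (dom i `&` dom j)) (transition i j);
  atlas_hausdorff : forall p q : A, p <> q -> exists U V : set A,
    [/\ atlas_open U, atlas_open V, U p, V q & U `&` V = set0];
  atlas_second_countable : exists B : nat -> set A,
    (forall k, atlas_open (B k)) /\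
    (forall (U : set A) p, atlas_open U -> U p ->
       exists k, B k p /\ B k `<=` U) }.

Record manifold (R : realType) (n : nat) := Manifold {
  manifold_atlas :> atlas R n;
  manifoldP : is_manifold manifold_atlas }.

Section Manifold.
Context {R : realType} {n : nat}.

(* A vector at [p] is the family of its components in the charts at [p]; the
   components in the other charts are set to [0]. *)
Definition components (A : atlas R n) := chart A -> 'rV[R]_n.

Definition is_tangent (A : atlas R n) (p : A) (v : components A) : Prop :=
  (forall i j, dom i p -> dom j p ->
     v j = 'D_(v i) (transition i j) (coord i p)) /\
  (forall i, ~ dom i p -> v i = 0).

Record tangent (A : atlas R n) (p : A) := Tangent {
  tangent_components :> components A;
  tangentP : is_tangent p tangent_components }.

(* The Gram matrices, in each chart, of a field of bilinear forms. *)
Definition gram_field (A : atlas R n) := chart A -> 'rV[R]_n -> 'M[R]_n.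

Record is_riemannian (A : atlas R n) (g : gram_field A) : Prop :=
  IsRiemannian {
  metric_sym : forall (i : chart A) p, dom i p ->
    (g i (coord i p))^T = g i (coord i p);
  metric_pos : forall (i : chart A) p, dom i p ->
    forall v, v != 0 -> 0 < inner (g i) (coord i p) v v;
  metric_smooth : forall i : chart A, smooth_on (coord i @` dom i) (g i);
  metric_transition : forall (i j : chart A) p, dom i p -> dom j p ->
    forall v w, inner (g i) (coord i p) v w =
      inner (g j) (coord j p) ('D_v (transition i j) (coord i p))
                              ('D_w (transition i j) (coord i p)) }.

Record riemannian_metric (A : atlas R n) := RiemannianMetric {
  metric_gram :> gram_field A;
  riemannianP : is_riemannian metric_gram }.

Section InChart.
Variables (A : atlas R n) (g : gram_field A) (i : chart A) (p : A).
Implicit Types X Y Z : components A.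

Definition dot X Y : R := inner (g i) (coord i p) (X i) (Y i).

Definition tnorm X : R := Num.sqrt (dot X X).

Definition sectional_curvature X Y : R :=
  sectional (g i) (coord i p) (X i) (Y i).

End InChart.

Definition curvature_tensor (A : atlas R n) (g : gram_field A) (p : A)
    (X Y Z : components A) : components A :=
  fun i => curvature (g i) (coord i p) (X i) (Y i) (Z i).

(* [A] induces on the tangent bundle the charts
   [(p, u) |-> (x, y) = (coord i p, u i)], with transition functions
   [(x, y) |-> (tau x, d tau_x (y))]. *)
Definition tangent_bundle (A : atlas R n) : atlas R (n + n) :=
  @Atlas R (n + n) {p : A & tangent p} (chart A)
    (fun i => [set q | dom i (projT1 q)])
    (fun i q => row_mx (coord i (projT1 q)) (tangent_components (projT2 q) i))
    (fun i j z => row_mx (transition i j (lsubmx z))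
                         ('D_(rsubmx z) (transition i j) (lsubmx z))).

Lemma tangent_bundle_transitionE (A : atlas R n) (i j : chart A)
    (q : tangent_bundle A) :
    is_manifold A -> dom i (projT1 q) -> dom j (projT1 q) ->
  @coord _ _ (tangent_bundle A) j q =
  @transition _ _ (tangent_bundle A) i j (@coord _ _ (tangent_bundle A) i q).
Proof.
case: q => p [v [v_tangent v0]] /= mA pi pj.
by rewrite row_mxKl row_mxKr -(transitionE mA pi pj) -(v_tangent i j).
Qed.

End Manifold.

(* In the coordinates [z = (x, y)] of an induced chart of the tangent bundle,
   [y] stands for the vector [u]. *)
Section TangentBundleMetric.
Context {R : realType} {n : nat}.
Implicit Types (a b : R -> R) (G : 'rV[R]_n -> 'M[R]_n).
Implicit Types (z xi eta : 'rV[R]_(n + n)) (v w : 'rV[R]_n).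

(* The velocity at [z] of the parallel vector fields along the curves with
   velocity [v]. *)
Definition hlift_coord G z v : 'rV[R]_(n + n) :=
  row_mx v (- christoffel_form G (lsubmx z) v (rsubmx z)).

Definition vlift_coord v : 'rV[R]_(n + n) := row_mx 0 v.

(* See [hlift_vlift_split]. *)
Definition vpart G z xi : 'rV[R]_n :=
  rsubmx xi + christoffel_form G (lsubmx z) (lsubmx xi) (rsubmx z).

(* The function [t], as seen in the induced chart. *)
Definition energy G z : R := 2^-1 * inner G (lsubmx z) (rsubmx z) (rsubmx z).

(* The form characterized by [gA_hlift_hlift], [gA_hlift_vlift] and
   [gA_vlift_vlift] below. *)
Definition gA_form a b G z xi eta : R :=
  inner G (lsubmx z) (lsubmx xi) (lsubmx eta)
  + a (energy G z) * inner G (lsubmx z) (vpart G z xi) (vpart G z eta)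
  + b (energy G z) * inner G (lsubmx z) (vpart G z xi) (rsubmx z)
                   * inner G (lsubmx z) (vpart G z eta) (rsubmx z).

Definition gA_gram a b G z : 'M[R]_(n + n) :=
  \matrix_(k, l) gA_form a b G z (delta_mx 0 k) (delta_mx 0 l).

Definition gA (A : atlas R n) a b (g : gram_field A) :
    gram_field (tangent_bundle A) :=
  fun i => gA_gram a b (g i).

Definition hlift (A : atlas R n) (g : gram_field A) (q : tangent_bundle A)
    (X : components A) : components (tangent_bundle A) :=
  fun i : chart A => hlift_coord (g i) (@coord _ _ (tangent_bundle A) i q) (X i).

Definition vlift (A : atlas R n) (X : components A) :
    components (tangent_bundle A) :=
  fun i : chart A => vlift_coord (X i).

Lemma christoffel_form_bilinear G x (c : R) :
  (forall v v' w, christoffel_form G x (c *: v + v') w =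
     c *: christoffel_form G x v w + christoffel_form G x v' w) /\
  (forall v w w', christoffel_form G x v (c *: w + w') =
     c *: christoffel_form G x v w + christoffel_form G x v w').
Proof.
split=> [v v' w|v w w']; apply/rowP => k; rewrite !mxE big_distrr -big_split;
  apply: eq_bigr => i _ /=; rewrite big_distrr -big_split;
  by apply: eq_bigr => j _ /=; rewrite !mxE; ring.
Qed.

Lemma inner_linear G x (c : R) v v' w :
  inner G x (c *: v + v') w = c * inner G x v w + inner G x v' w.
Proof. by rewrite /inner !mulmxDl -!scalemxAl !mxE. Qed.

Lemma inner_linear_r G x (c : R) v v' w :
  inner G x w (c *: v + v') = c * inner G x w v + inner G x w v'.
Proof. by rewrite /inner linearP mulmxDr -scalemxAr !mxE. Qed.

Lemma vpart_linear G z (c : R) xi eta :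
  vpart G z (c *: xi + eta) = c *: vpart G z xi + vpart G z eta.
Proof.
rewrite /vpart !linearP (christoffel_form_bilinear _ _ _).1.
by rewrite scalerDr addrACA.
Qed.

Lemma gA_gramE a b G z xi eta :
  inner (gA_gram a b G) z xi eta = gA_form a b G z xi eta.
Proof.
have linl c xi' xi'' eta' : gA_form a b G z (c *: xi' + xi'') eta' =
    c * gA_form a b G z xi' eta' + gA_form a b G z xi'' eta'.
  by rewrite /gA_form linearP vpart_linear !inner_linear; ring.
have linr c xi' xi'' eta' : gA_form a b G z eta' (c *: xi' + xi'') =
    c * gA_form a b G z eta' xi' + gA_form a b G z eta' xi''.
  by rewrite /gA_form linearP vpart_linear !inner_linear_r !inner_linear; ring.
have zl eta' : gA_form a b G z 0 eta' = 0.
  by have := linl (-1) 0 0 eta'; rewrite scaler0 addr0 mulN1r addNr.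
have zr eta' : gA_form a b G z eta' 0 = 0.
  by have := linr (-1) 0 0 eta'; rewrite scaler0 addr0 mulN1r addNr.
have suml I (r : seq I) (F : I -> 'rV[R]_(n + n)) c eta' :
    gA_form a b G z (\sum_(i <- r) c i *: F i) eta' =
    \sum_(i <- r) c i * gA_form a b G z (F i) eta'.
  by elim: r => [|i r IH]; rewrite ?big_nil // !big_cons linl IH.
have sumr I (r : seq I) (F : I -> 'rV[R]_(n + n)) c eta' :
    gA_form a b G z eta' (\sum_(i <- r) c i *: F i) =
    \sum_(i <- r) c i * gA_form a b G z eta' (F i).
  by elim: r => [|i r IH]; rewrite ?big_nil // !big_cons linr IH.
rewrite innerE {2}[xi]row_sum_delta {2}[eta]row_sum_delta suml.
apply: eq_bigr => k _; rewrite sumr big_distrr /=; apply: eq_bigr => l _.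
by rewrite mxE; ring.
Qed.

Lemma hlift_vlift_split G z xi :
  xi = hlift_coord G z (lsubmx xi) + vlift_coord (vpart G z xi).
Proof.
by rewrite -[LHS]hsubmxK add_row_mx addr0 /vpart addrCA addNr addr0.
Qed.

Lemma vpart_hlift G z v : vpart G z (hlift_coord G z v) = 0.
Proof. by rewrite /vpart row_mxKl row_mxKr addNr. Qed.

Lemma vpart_vlift G z v : vpart G z (vlift_coord v) = v.
Proof.
rewrite /vpart row_mxKl row_mxKr -[X in _ + X](_ : 0 = _) ?addr0 //.
apply/rowP => k; rewrite !mxE big1 // => i _; rewrite big1 // => j _.
by rewrite mxE !mul0r.
Qed.

Lemma inner0l G x v : inner G x 0 v = 0.
Proof. by rewrite /inner !mul0mx mxE. Qed.

Lemma inner0r G x v : inner G x v 0 = 0.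
Proof. by rewrite /inner trmx0 mulmx0 mxE. Qed.

Lemma gA_hlift_hlift a b G z v w :
  inner (gA_gram a b G) z (hlift_coord G z v) (hlift_coord G z w) =
  inner G (lsubmx z) v w.
Proof.
by rewrite gA_gramE /gA_form !vpart_hlift !row_mxKl !inner0l !mulr0 !addr0.
Qed.

Lemma gA_hlift_vlift a b G z v w :
  inner (gA_gram a b G) z (hlift_coord G z v) (vlift_coord w) = 0.
Proof.
rewrite gA_gramE /gA_form vpart_hlift vpart_vlift !row_mxKl.
by rewrite inner0r !inner0l !mulr0 mul0r !addr0.
Qed.

Lemma gA_vlift_vlift a b G z v w :
  inner (gA_gram a b G) z (vlift_coord v) (vlift_coord w) =
  a (energy G z) * inner G (lsubmx z) v w
  + b (energy G z) * inner G (lsubmx z) v (rsubmx z)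
                   * inner G (lsubmx z) w (rsubmx z).
Proof. by rewrite gA_gramE /gA_form !vpart_vlift !row_mxKl inner0r add0r. Qed.

End TangentBundleMetric.

Section CurvatureFunctions.
Context {R : realType}.
Variables a b : R -> R.
Let a' := hl_derive a.
Let b' := hl_derive b.

Definition fL (t : R) : R := a' t / (2 * a t).
Definition fM (t : R) : R := (2 * b t - a' t) / (2 * (a t + 2 * t * b t)).
Definition fN (t : R) : R :=
  (a t * b' t - 2 * a' t * b t) / (2 * a t * (a t + 2 * t * b t)).

Definition F1 (t : R) : R :=
  hl_derive fL t - fL t ^+ 2 - fN t * (1 + 2 * t * fL t).
Definition F2 (t : R) : R := fL t - fM t * (1 + 2 * t * fL t).
Definition F3 (t : R) : R :=
  fN t - (hl_derive fM t + fM t ^+ 2 + 2 * t * fM t * fN t).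

End CurvatureFunctions.

(* Main.v *)
From HB Require Import structures.
Require Import Defs.
From mathcomp Require Import all_boot all_order all_algebra.
From mathcomp Require Import all_classical all_reals all_analysis.
From mathcomp Require Import ring lra.

Set Implicit Arguments.
Unset Strict Implicit.
Unset Printing Implicit Defensive.

Import Order.TTheory GRing.Theory Num.Theory.
Import numFieldNormedType.Exports.

Local Open Scope classical_set_scope.
Local Open Scope ring_scope.

(* Lowering an index, for constant coordinate fields V and W,
     <R_VW W, V> = D_V <nabla_W W, V> - D_W <nabla_V W, V>
                   - <nabla_W W, nabla_V V> + |nabla_V W|^2,
   so only the covariant connection has to be differentiated.  In an induced
   chart the Levi-Civita connection of g_A is given by an explicit formula,
   recognized through its symmetry and its compatibility with g_A; once lowered,
   the curvature of g only occurs in it paired with vertical parts.  The vertical part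
   of a constant field extending a horizontal vector vanishes at the point, so
   the derivative of the curvature drops out: for (X^H, Y^H) the vertical terms
   add up to -3/4 a |R_XY u|^2, for (X^H, Y^V) only the horizontal part
   (a/2) R_uY X of nabla_X^H Y^V survives, and for (X^V, Y^V) the computation
   takes place in a fiber and reduces to the relations a' = 2aL,
   b = M(a + 2tb) + aL and b' = 2N(a + 2tb) + 4Lb.  At t = 0 the one-sided
   derivatives of a and b are derivatives of extensions that are affine on the
   negative half-line, which yields the chain rule along t. *)

(** * Half-line derivatives and symmetry of second derivatives *)

(** The differential of [f] also realizes the first-order expansion of [g] at [x], and [diff_unique]
    identifies it with the differential of [g]. *)
Lemma near_eq_differentiable (R : realType) (V W : normedModType R)
    (f g : V -> W) (x : V) :
  (\near x, f x = g x) -> differentiable f x -> differentiable g x.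
Proof.
move=> fg df.
have fgx : f x = g x := nbhs_singleton fg.
have dg : g \o shift x = cst (g x) + 'd f x +o_ 0 id.
  apply/eqaddoP => _/posnumP[e].
  have /eqaddoP/(_ e%:num)/(_ [gt0 of e%:num]) := diff_locally df.
  apply: filter_app; rewrite near_simpl.
  have : \forall h \near 0, f (h + x) = g (h + x).
    by move: fg; rewrite (near_shift 0 x) subr0.
  by apply: filterS => h fgh; rewrite !fctE /= fgh fgx.
have cdf : continuous ('d f x) by exact: diff_continuous.
by apply/diff_locallyP; rewrite (diff_unique cdf dg); split.
Qed.

Section HalfLine.
Context {R : realType}.

Lemma hl_filter_proper (t : R) : 0 <= t -> ProperFilter (hl_filter t).
Proof.
move=> t0; apply: Build_ProperFilter_ex => P.
rewrite /hl_filter /within /= => -[e /= e0 Pe].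
exists (t + e / 2).
apply: (Pe (t + e / 2)) => /=.
- by rewrite opprD addrA subrr add0r normrN gtr0_norm ?divr_gt0 // ltr_pdivrMr // ltr_pMr // ltr1n.
- by rewrite gt_eqF // ltrDl divr_gt0.
- by rewrite addr_ge0 // divr_ge0 // ltW.
Qed.

(** The extension is tailored to [t]: at a negative point its difference quotient at [t] is exactly
    [hl_derive f t], and at a nonnegative point it is the half-line quotient. The two-sided limit
    therefore follows from the one within the half-line, also at [t = 0]. *)
Lemma hl_derive_extension (f : R -> R) (t : R) : 0 <= t ->
    cvg (hl_quotient f t @ hl_filter t) ->
  is_derive t (1 : R)
    (fun s => if 0 <= s then f s else f t + hl_derive f t * (s - t))
    (hl_derive f t).
Proof.
move=> t0 df.
set g : R -> R := fun s => _.
have gt : g t = f t by rewrite /g t0.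
suff cg : (fun h => h^-1 *: ((g \o shift t) (h *: (1 : R)) - g t)) @ 0^' -->
    hl_derive f t.
  by apply: DeriveDef; [apply/cvg_ex; exists (hl_derive f t) | exact: cvg_lim].
have dl : hl_quotient f t @ hl_filter t --> hl_derive f t by exact: df.
have ? := hl_filter_proper t0.
apply/cvgrPdist_le => e e0.
have [d /= d0 dP] := (cvgrPdist_le _ _).1 dl e e0.
exists d => //= h /=; rewrite sub0r normrN => hd h0.
rewrite gt /shift /= [h *: 1]mulr1 /g; case: ifPn => hs.
  have := dP (h + t); rewrite /= opprD addrCA subrr addr0 normrN => /(_ hd).
  rewrite -subr_eq0 addrK => /(_ h0 hs).
  by rewrite /hl_quotient addrK [_ *: _]mulrC.
by rewrite [f t + _]addrC addrK addrK [_ *: _]mulrC mulfK // subrr normr0 ltW.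
Qed.

Lemma near_extension (V : normedModType R) (f : R -> R) (h : V -> R) c (x : V) :
    (\forall y \near x, 0 <= h y) ->
  \forall y \near x, (if 0 <= h y then f (h y) else c y) = f (h y).
Proof. by apply: filterS => y ->. Qed.

(** The value [h x] may be 0, where [f] has only a one-sided derivative. As [h] stays nonnegative
    near [x], [f] may be replaced there by its two-sided extension, to which the ordinary chain rule
    applies. *)
Lemma hl_differentiable (V : normedModType R) (f : R -> R) (h : V -> R) (x : V) :
    (\forall y \near x, 0 <= h y) -> differentiable h x ->
    cvg (hl_quotient f (h x) @ hl_filter (h x)) ->
  differentiable (fun y => f (h y)) x.
Proof.
move=> h0 dh df; have := hl_derive_extension (nbhs_singleton h0) df.
set g := fun s => _; move=> [/derivable1_diffP dg _].
apply: (near_eq_differentiable (f := g \o h)) (differentiable_comp dh dg).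
exact: near_extension.
Qed.

Lemma hl_is_derive (V : normedModType R) (f : R -> R) (h : V -> R) (x v : V) dh :
    (\forall y \near x, 0 <= h y) -> differentiable h x -> is_derive x v h dh ->
    cvg (hl_quotient f (h x) @ hl_filter (h x)) ->
  is_derive x v (fun y => f (h y)) (hl_derive f (h x) * dh).
Proof.
move=> h0 dfh [_ <-] df; have := hl_derive_extension (nbhs_singleton h0) df.
set g := fun s => _; move=> [/derivable1_diffP dg g'].
have dgh : differentiable (g \o h) x by exact: differentiable_comp.
apply: (near_eq_is_derive (f := g \o h)); first exact: near_extension.
apply: DeriveDef; first exact: diff_derivable.
have lin : 'd g (h x) ('d h x v) = 'd h x v * 'd g (h x) 1.
  by rewrite -[in LHS](mulr1 ('d h x v)) [LHS]linearZ.
by rewrite deriveE // diff_comp //= lin -[X in _ * X]deriveE // g' deriveE // mulrC.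
Qed.

End HalfLine.

Section Schwarz.
Context {R : realType} {V : normedModType R}.
Variables (f : V -> R) (O : set V).
Hypothesis O_open : open O.
Hypothesis f_diff : forall x, O x -> differentiable f x.

Lemma is_derive_line (x v : V) (s : R) : O (s *: v + x) ->
  is_derive s (1 : R) (fun s : R => f (s *: v + x)) ('D_v f (s *: v + x)).
Proof.
move=> Ox; have [dl dlE] : is_diff s (fun s : R => s *: v + x) ( *:%R ^~ v + 0).
  exact: is_diffD.
have df := f_diff Ox.
apply: DeriveDef.
  by apply/derivable1_diffP; exact: (differentiable_comp dl df).
rewrite deriveE; last exact: (differentiable_comp dl df).
by rewrite (diff_comp dl df) /= dlE !fctE addr0 scale1r -deriveE.
Qed.

(** The mean value theorem, applied to [phi s = f (s v + h w + x) - f (s v + x)] on [[0, h]], turns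
    the second difference into [h] times a difference of two values of ['D_v f]; both values are
    then expanded to first order at [x]. *)
Lemma second_difference (x v w : V) (e : R) : O x -> 0 < e ->
    differentiable (fun y => 'D_v f y) x ->
  \forall h \near 0^'+,
    `|f (h *: v + (h *: w + x)) - f (h *: v + x) - f (h *: w + x) + f x
      - h ^+ 2 * 'D_w (fun y => 'D_v f y) x| <= e * h ^+ 2.
Proof.
move=> Ox e0 dF; pose F : V -> R := fun y => 'D_v f y.
(* The two remainders occur at increments of norm at most [h (|v| + |w|)] and [h |v|], which add up
   to at most [h C]; the summand 1 keeps [C] positive. *)
pose C := `|v| + `|v| + `|w| + 1.
have C0 : 0 < C by rewrite ltr_wpDl // !addr_ge0.
have eC0 : 0 < e / C by rewrite divr_gt0.
have nbhsP : \forall k \near (0 : V), O (k + x) /\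
    `|F (k + x) - F x - 'd F x k| <= e / C * `|k|.
  have /eqaddoP/(_ (e / C) eC0) := diff_locally dF.
  rewrite near_simpl => F1; apply: filterS2 F1 _ => [k F1 Ok|].
    split; first exact: Ok.
    by move: F1; rewrite !fctE /= opprD addrA.
  have : \forall y \near x, O y by exact: open_nbhs_nbhs.
  by rewrite (near_shift 0 x) subr0.
have /nbhs_normP[d /= d0 dP] := nbhsP.
have small (k : V) (h : R) : 0 < h -> h < d / C -> `|k| <= h * (`|v| + `|w|) ->
    O (k + x) /\ `|F (k + x) - F x - 'd F x k| <= e / C * `|k|.
  move=> h0 hd kh; apply: dP; rewrite /= sub0r normrN.
  apply: le_lt_trans kh _; apply: (@lt_le_trans _ _ (h * C)).
    by rewrite ltr_pM2l // /C; have := normr_ge0 v; lra.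
  by rewrite -ler_pdivlMr // ltW.
near=> h.
have h0 : 0 < h by [].
have hd : h < d / C.
  by near: h; apply: nbhs_right_lt; rewrite divr_gt0.
have ks (s : R) : 0 <= s <= h -> `|s *: v + h *: w| <= h * (`|v| + `|w|) /\
    `|s *: v| <= h * (`|v| + `|w|) /\ `|s *: v| <= h * `|v|.
  move=> /andP[s0 sh]; have sv : `|s *: v| <= h * `|v|.
    by rewrite normrZ ger0_norm // ler_wpM2r.
  split; last by split => //; rewrite mulrDr (le_trans sv) // lerDl mulr_ge0 // ltW.
  by rewrite (le_trans (ler_normD _ _)) // mulrDr lerD // normrZ gtr0_norm.
pose phi (s : R) := f (s *: v + (h *: w + x)) - f (s *: v + x).
have dphi (s : R) : 0 <= s <= h ->
    is_derive s (1 : R) phi (F (s *: v + (h *: w + x)) - F (s *: v + x)).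
  move=> sh; have [k1 [k2 _]] := ks s sh.
  apply: is_deriveB; apply: is_derive_line; last exact: (small _ _ h0 hd k2).1.
  by rewrite addrA; exact: (small _ _ h0 hd k1).1.
have [||c ch E] := @MVT R phi (fun s => F (s *: v + (h *: w + x)) - F (s *: v + x)) 0 h h0.
- by move=> s; rewrite in_itv /= => /andP[s0 sh]; apply: dphi; rewrite !ltW.
- apply: derivable_within_continuous => s; rewrite in_itv /= => sh.
  by have [] := dphi s sh.
have {}ch : 0 <= c <= h by move: ch; rewrite in_itv /= => /andP[? ?]; rewrite !ltW.
have [k1 [k2 k3]] := ks c ch.
have [_ b1] := small _ _ h0 hd k1; have [_ b2] := small _ _ h0 hd k2.
move: E; rewrite /phi !scale0r !add0r subr0 => E.
rewrite opprB addrA in E.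
set A := _ - h ^+ 2 * _.
(* The linear parts at [c v + h w] and at [c v] differ by [h] times ['d F x w], which accounts for
   the term in [h ^+ 2]; what is left is a difference of two remainders, times [h]. *)
have -> : A = ((F (c *: v + h *: w + x) - F x - 'd F x (c *: v + h *: w))
   - (F (c *: v + x) - F x - 'd F x (c *: v))) * h.
  have -> : 'd F x (c *: v + h *: w) = 'd F x (c *: v) + h * 'd F x w.
    by rewrite linearD; congr (_ + _); exact: linearZ.
  rewrite /A deriveE // -(addrA (c *: v)).
  transitivity ((F (c *: v + (h *: w + x)) - F (c *: v + x)) * h - h ^+ 2 * 'd F x w).
    by rewrite -E; ring.
  by ring.
rewrite normrM [`|h|]gtr0_norm // expr2 [_ * (h * h)]mulrA ler_pM2r //.
apply: le_trans (ler_normB _ _) _; apply: le_trans (lerD b1 b2) _.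
rewrite -mulrDr mulrAC ler_pdivrMr // -mulrA ler_pM2l // /C.
have -> : h * (`|v| + `|v| + `|w| + 1) = h * (`|v| + `|w|) + h * `|v| + h by ring.
by apply: le_trans (lerD k1 k3) _; rewrite lerDl ltW.
Unshelve. all: by end_near. Qed.

(** The second difference is symmetric in [v] and [w], so for small [h > 0] both mixed derivatives
    times [h ^+ 2] lie within [e / 2 * h ^+ 2] of the same number. *)
Lemma derive_comm (x v w : V) : O x ->
    (forall u, differentiable (fun y => 'D_u f y) x) ->
  'D_v (fun y => 'D_w f y) x = 'D_w (fun y => 'D_v f y) x.
Proof.
move=> Ox dF; apply/eqP; rewrite -subr_eq0 -normr_le0; apply/ler_addgt0Pl => e e0.
rewrite addr0; have e20 : 0 < e / 2 by rewrite divr_gt0.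
have A := second_difference (v := v) w Ox e20 (dF v).
have B := second_difference (v := w) v Ox e20 (dF w).
have [h [[{}A {}B] h0]] := filter_ex (filterI (filterI A B) (nbhs_right_gt (0 : R))).
have h20 : 0 < h ^+ 2 by rewrite exprn_gt0.
rewrite -(ler_pM2r h20) [e](splitr e) mulrDl.
apply: le_trans (lerD A B); rewrite -[X in _ * X](gtr0_norm h20) -normrM.
rewrite -[X in _ <= _ + X]normrN; apply: le_trans (ler_normD _ _).
rewrite le_eqVlt; apply/orP; left; apply/eqP; congr (`|_|).
rewrite (addrCA (h *: w)); move: (derive _ _ v) (derive _ _ w) (f _) (f (_ + x)) (f (_ + x)).
by move=> *; ring.
Qed.

End Schwarz.

(** * Smooth functions *)

Section SmoothFunctions.
Context {R : realType}.

(* Each clause is stable under differentiation, so that these functions are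
   infinitely differentiable on [O] although no iterated derivative occurs. *)
Inductive smooth {m : nat} (O : set 'rV[R]_m) : ('rV[R]_m -> R) -> Prop :=
| smooth_entry k l (F : 'rV[R]_m -> 'M[R]_(k, l)) i j :
    smooth_on O F -> smooth O (fun x => F x i j)
| smooth_coord i : smooth O (fun x => x 0 i)
| smooth_cst c : smooth O (fun=> c)
| smooth_add f g : smooth O f -> smooth O g -> smooth O (fun x => f x + g x)
| smooth_mul f g : smooth O f -> smooth O g -> smooth O (fun x => f x * g x)
| smooth_inv f : (forall x, O x -> f x != 0) -> smooth O f ->
    smooth O (fun x => (f x)^-1)
| smooth_hl (phi : R -> R) f : hl_smooth phi -> (forall x, O x -> 0 <= f x) ->
    smooth O f -> smooth O (fun x => phi (f x))
| smooth_ext f g : (forall x, O x -> f x = g x) -> smooth O f -> smooth O g.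

Lemma hl_smooth_derive (phi : R -> R) : hl_smooth phi -> hl_smooth (hl_derive phi).
Proof. by move=> H k t t0; rewrite -iterSr; exact: H. Qed.

Lemma hl_smooth_cvg (phi : R -> R) t : hl_smooth phi -> 0 <= t ->
  cvg (hl_quotient phi t @ hl_filter t).
Proof. by move=> H t0; exact: (H 0%N). Qed.

Lemma smooth_on_derive m (W : normedModType R) (O : set 'rV[R]_m)
    (F : 'rV[R]_m -> W) v : smooth_on O F -> smooth_on O (fun x => 'D_v F x).
Proof.
move=> sF s x Ox; have := sF (rcons s v) x Ox.
by rewrite /iter_derive -cats1 foldr_cat.
Qed.

Lemma open_near (T : topologicalType) (O : set T) (P : T -> Prop) x : open O -> O x ->
  (forall y, O y -> P y) -> \forall y \near x, P y.
Proof.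
by move=> oO Ox OP; apply: filterS OP _; apply: open_nbhs_nbhs; split.
Qed.

(** Induction on the clauses. The two claims go together: differentiability of the parts justifies
    the sum, product, inverse and chain rules, and the formulas these rules give stay in the
    class. *)
Lemma smooth_derive m (O : set 'rV[R]_m) f : open O -> smooth O f ->
  (forall x, O x -> differentiable f x) /\ forall v, smooth O (fun x => 'D_v f x).
Proof.
move=> oO; elim=> {f}.
- move=> k l F i j sF; have dF x : O x -> differentiable F x := sF [::] x.
  split=> [x Ox|v].
    exact: (differentiable_comp (dF x Ox) (differentiable_coord _ _ _)).
  apply: smooth_ext (smooth_entry i j (smooth_on_derive v sF)) => x Ox.
  by rewrite derive_mx ?mxE //; apply: diff_derivable; exact: dF.
- move=> i; split=> [x _|v]; first exact: differentiable_coord.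
  apply: smooth_ext (smooth_cst O (v 0 i)) => x Ox.
  have := congr1 (fun A : 'rV[R]_m => A 0 i) (derive_mx (@derivable_id _ _ x v)).
  by rewrite derive_id mxE.
- move=> c; split=> [x _|v]; first exact: differentiable_cst.
  by apply: smooth_ext (smooth_cst O 0) => x Ox; rewrite derive_cst.
- move=> f g sf [df Df] sg [dg Dg]; split=> [x Ox|v].
    by apply: differentiableD; [exact: df|exact: dg].
  apply: smooth_ext (smooth_add (Df v) (Dg v)) => x Ox.
  by rewrite [RHS]deriveD //; apply: diff_derivable; [exact: df|exact: dg].
- move=> f g sf [df Df] sg [dg Dg]; split=> [x Ox|v].
    by apply: differentiableM; [exact: df|exact: dg].
  apply: smooth_ext (smooth_add (smooth_mul sf (Dg v)) (smooth_mul sg (Df v))) => x Ox.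
  by rewrite [RHS]deriveM //; apply: diff_derivable; [exact: df|exact: dg].
- move=> f f0 sf [df Df]; split=> [x Ox|v].
    by apply: differentiableV; [exact: df|exact: f0].
  have s2 := smooth_mul (smooth_inv f0 sf) (smooth_inv f0 sf).
  apply: smooth_ext (smooth_mul (smooth_mul (smooth_cst O (-1)) s2) (Df v)) => x Ox.
  rewrite [RHS]deriveV ?f0 //; last exact/diff_derivable/df.
  by rewrite expr2 invfM mulN1r.
- move=> phi f sphi f0 sf [df Df].
  have nf0 x : O x -> \forall y \near x, 0 <= f y by move=> Ox; exact: open_near f0.
  split=> [x Ox|v].
    by apply: hl_differentiable; [exact: nf0|exact: df|exact: hl_smooth_cvg (f0 x Ox)].
  apply: smooth_ext (smooth_mul (smooth_hl (hl_smooth_derive sphi) f0 sf) (Df v)) => x Ox.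
  symmetry; apply: derive_val; apply: hl_is_derive.
  + exact: nf0.
  + exact: df.
  + exact/derivableP/diff_derivable/df.
  + exact: hl_smooth_cvg (f0 x Ox).
- move=> f g fg sf [df Df]; split=> [x Ox|v].
    by apply: near_eq_differentiable (df x Ox); exact: open_near fg.
  apply: smooth_ext (Df v) => x Ox; apply: near_eq_derive; exact: open_near fg.
Qed.

Lemma smooth_diff m (O : set 'rV[R]_m) f x : open O -> smooth O f -> O x ->
  differentiable f x.
Proof. by move=> oO sf; apply: (smooth_derive oO sf).1. Qed.

Lemma smooth_D m (O : set 'rV[R]_m) f v : open O -> smooth O f ->
  smooth O (fun x => 'D_v f x).
Proof. by move=> oO sf; apply: (smooth_derive oO sf).2. Qed.

Lemma smooth_scale m (O : set 'rV[R]_m) (c : R) f : smooth O f -> smooth O (fun x => c * f x).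
Proof. by move=> sf; apply: smooth_mul sf; exact: smooth_cst. Qed.

Lemma smooth_opp m (O : set 'rV[R]_m) f : smooth O f -> smooth O (fun x => - f x).
Proof.
move=> sf; apply: smooth_ext (smooth_mul (smooth_cst O (-1)) sf) => x _.
by rewrite mulN1r.
Qed.

Lemma smooth_sum m (O : set 'rV[R]_m) I (r : seq I) (P : pred I) (f : I -> 'rV[R]_m -> R) :
  (forall i, smooth O (f i)) -> smooth O (fun x => \sum_(i <- r | P i) f i x).
Proof.
move=> sf; elim: r => [|i r IH].
  by apply: smooth_ext (smooth_cst O 0) => x _; rewrite big_nil.
apply: (@smooth_ext _ _ (fun x => (P i)%:R * f i x + \sum_(i <- r | P i) f i x)).
  by move=> x _; rewrite big_cons; case: (P i); rewrite ?mul1r ?mul0r ?add0r.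
by apply: smooth_add IH; exact: smooth_scale.
Qed.

Lemma smooth_prod m (O : set 'rV[R]_m) I (r : seq I) (f : I -> 'rV[R]_m -> R) :
  (forall i, smooth O (f i)) -> smooth O (fun x => \prod_(i <- r) f i x).
Proof.
move=> sf; elim: r => [|i r IH].
  by apply: smooth_ext (smooth_cst O 1) => x _; rewrite big_nil.
apply: smooth_ext (smooth_mul (sf i) IH) => x _; by rewrite big_cons.
Qed.

Lemma smooth_det m (O : set 'rV[R]_m) k (F : 'rV[R]_m -> 'M[R]_k) :
  (forall i j, smooth O (fun x => F x i j)) -> smooth O (fun x => \det (F x)).
Proof.
move=> sF; apply: smooth_sum => s; apply: smooth_scale.
by apply: smooth_prod => i.
Qed.

Lemma smooth_invmx m (O : set 'rV[R]_m) k (F : 'rV[R]_m -> 'M[R]_k) i j :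
  (forall x, O x -> F x \in unitmx) -> (forall i j, smooth O (fun x => F x i j)) ->
  smooth O (fun x => invmx (F x) i j).
Proof.
move=> uF sF.
(* Cramer's rule: the entry is a polynomial in the entries of [F x] divided by a determinant that
   does not vanish on [O]. *)
apply: (@smooth_ext _ _ (fun x => (\det (F x))^-1 * cofactor (F x) j i)).
  by move=> x Ox; rewrite /invmx uF // !mxE.
apply: smooth_mul.
  apply: smooth_inv; last exact: smooth_det.
  by move=> x Ox; rewrite -unitfE -unitmxE uF.
apply: smooth_scale; apply: smooth_det => a b.
by apply: smooth_ext (sF _ _) => x _; rewrite !mxE.
Qed.

Lemma smooth_on_lsubmx n k l (U : set 'rV[R]_n) (F : 'rV[R]_n -> 'M[R]_(k, l)) :
  open U -> smooth_on U F ->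
  smooth_on (lsubmx @^-1` U) (fun z : 'rV[R]_(n + n) => F (lsubmx z)).
Proof.
move=> oU sF s.
have oO : open ((lsubmx : 'rV[R]_(n + n) -> 'rV[R]_n) @^-1` U).
  by apply: open_comp => // z _; exact: continuous_lsubmx.
(* The projection is linear, so an iterated derivative of the pulled-back field is the pull-back of
   the iterated derivative along the projected directions. *)
have E z : U (lsubmx z) -> iter_derive s (fun z : 'rV[R]_(n + n) => F (lsubmx z)) z
    = iter_derive (map (fun v : 'rV[R]_(n + n) => lsubmx v) s) F (lsubmx z).
  elim: s z => //= v s IH z Uz.
  set DF := iter_derive _ F.
  rewrite (near_eq_derive (g := fun z => DF (lsubmx z))); last first.
    exact: open_near IH.
  have dF : differentiable DF (lsubmx z) by exact: sF.
  have dl := differentiable_lsubmx z.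
  rewrite [LHS]deriveE; last exact: (differentiable_comp dl dF).
  rewrite [X in X _ = _](diff_comp dl dF) /= deriveE // diff_lin //.
  exact: continuous_lsubmx.
pose s' := map (fun v : 'rV[R]_(n + n) => lsubmx v) s.
move=> z Uz.
apply: (@near_eq_differentiable _ _ _ (fun z => iter_derive s' F (lsubmx z))).
  by apply: open_near Uz _ => // y Uy; rewrite E.
exact: (differentiable_comp (differentiable_lsubmx z) (sF _ _ Uz)).
Qed.

Lemma smooth_lsubmx n (U : set 'rV[R]_n) f : open U -> smooth U f ->
  smooth (lsubmx @^-1` U) (fun z : 'rV[R]_(n + n) => f (lsubmx z)).
Proof.
move=> oU; elim=> {f}.
- move=> k l F i j sF; exact: (smooth_entry i j (smooth_on_lsubmx oU sF)).
- move=> i; apply: smooth_ext (smooth_coord _ (lshift n i)) => z _; by rewrite mxE.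
- by move=> c; exact: smooth_cst.
- by move=> f g _ sf _ sg; exact: smooth_add.
- by move=> f g _ sf _ sg; exact: smooth_mul.
- by move=> f f0 _ sf; apply: smooth_inv => // z Uz; exact: f0.
- by move=> phi f sphi f0 _ sf; apply: (smooth_hl sphi) => // z Uz; exact: f0.
- by move=> f g fg _ sf; apply: smooth_ext sf => z Uz; exact: fg.
Qed.

End SmoothFunctions.

(** * The Levi-Civita connection of a field of Gram matrices *)

Lemma derivable_row (R : realType) (V : normedModType R) n (W : V -> 'rV[R]_n) x v :
  (forall j, derivable (fun y => W y 0 j) x v) -> derivable W x v.
Proof. by move=> dW; apply/derivable_mxP => i j; rewrite ord1. Qed.

Lemma differentiable_mx (R : realType) (V : normedModType R) k l
    (F : V -> 'M[R]_(k, l)) x :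
  (forall i j, differentiable (fun y => F y i j) x) -> differentiable F x.
Proof.
move=> dF; have -> : F = \sum_i \sum_j (fun y => F y i j *: delta_mx i j).
  apply/funext => y; rewrite {1}(matrix_sum_delta (F y)) fct_sumE.
  by apply: eq_bigr => i _; rewrite fct_sumE.
by do 2![apply: differentiable_sum => ?]; exact: differentiableZl.
Qed.

Lemma is_derive_entry (R : realType) (V : normedModType R) k l (W : V -> 'M[R]_(k, l))
    (x v : V) i j : derivable W x v ->
  is_derive x v (fun y => W y i j) ('D_v W x i j).
Proof.
move=> dW; apply: DeriveDef; first by move/derivable_mxP: dW => /(_ i j).
by rewrite derive_mx // mxE.
Qed.

Section MetricTheory.
Context {R : realType} {m : nat}.
Variables (G : 'rV[R]_m -> 'M[R]_m) (O : set 'rV[R]_m).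
Hypothesis O_open : open O.
Hypothesis G_smooth : forall i j, smooth O (fun x => G x i j).
Hypothesis G_sym : forall x, O x -> (G x)^T = G x.
Hypothesis G_unit : forall x, O x -> G x \in unitmx.
Implicit Types (x v w z u : 'rV[R]_m).

Local Notation Gamma := (christoffel_form G).
Local Notation "<< v , w >>_ x" := (inner G x v w) (x at level 8).

Lemma G_sym_near x : O x -> \forall y \near x, (G y)^T = G y.
Proof. by move=> Ox; exact: open_near G_sym. Qed.

Lemma G_diff x : O x -> differentiable G x.
Proof. by move=> Ox; apply: differentiable_mx => i j; exact: smooth_diff (G_smooth i j) Ox. Qed.

Lemma smooth_christoffel k i j : smooth O (christoffel G k i j).
Proof.
apply: smooth_scale; apply: smooth_sum => l; apply: smooth_mul; first exact: smooth_invmx.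
by apply: smooth_add; [apply: smooth_add|apply: smooth_opp]; exact: smooth_D.
Qed.

Lemma smooth_christoffel_form v w k : smooth O (fun x => Gamma x v w 0 k).
Proof.
apply: (@smooth_ext _ _ _ (fun x => \sum_i \sum_j v 0 i * w 0 j * christoffel G k i j x)).
  by move=> x _; rewrite /christoffel_form mxE.
by do 2![apply: smooth_sum => ?]; apply: smooth_scale; exact: smooth_christoffel.
Qed.

Lemma christoffel_form_diff v w x : O x -> differentiable (fun y => Gamma y v w) x.
Proof.
move=> Ox; apply: differentiable_mx => i j; rewrite ord1.
exact: smooth_diff (smooth_christoffel_form v w j) Ox.
Qed.

Lemma christoffel_formC x v w : O x -> Gamma x v w = Gamma x w v.
Proof.
move=> Ox; apply/rowP => k; rewrite !mxE exchange_big; apply: eq_bigr => i _.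
apply: eq_bigr => j _; rewrite mulrC [v 0 j * _]mulrC mulrC.
by rewrite (christoffel_sym (G_sym_near Ox)).
Qed.

Lemma innerC x v w : O x -> << v, w >>_x = << w, v >>_x.
Proof.
move=> Ox; rewrite /inner -[in LHS](trmxK (v *m G x *m w^T)) mxE.
by rewrite !trmx_mul trmxK G_sym // mulmxA.
Qed.

Lemma inner_nondeg x v : O x -> (forall w, << v, w >>_x = 0) -> v = 0.
Proof.
move=> Ox v0; have : v *m G x = 0.
  apply/rowP => j; have := v0 (delta_mx 0 j).
  by rewrite /inner trmx_delta -colE mxE => ->; rewrite mxE.
by move/(congr1 (fun A => A *m invmx (G x))); rewrite mulmxK ?G_unit // mul0mx.
Qed.

Lemma nabla_cst v w : nabla G (cst v) (cst w) = fun x => Gamma x v w.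
Proof. by apply/funext => x; rewrite /nabla derive_cst add0r. Qed.

Lemma derive_inner_cst x v w z : O x ->
  'D_v (fun y => << w, z >>_y) x = << Gamma x v w, z >>_x + << w, Gamma x v z >>_x.
Proof.
move=> Ox; have := nabla_metric (G_sym_near Ox) (G_unit Ox) (cst v) (G_diff Ox)
  (@differentiable_cst _ _ _ w x) (@differentiable_cst _ _ _ z x).
by rewrite !nabla_cst.
Qed.

Lemma christoffel_form_0l x w : Gamma x 0 w = 0.
Proof.
have := (christoffel_form_bilinear G x (-1)).1 0 0 w.
by rewrite scaler0 addr0 scaleN1r addNr.
Qed.

Lemma christoffel_form_0r x v : Gamma x v 0 = 0.
Proof.
have := (christoffel_form_bilinear G x (-1)).2 v 0 0.
by rewrite scaler0 addr0 scaleN1r addNr.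
Qed.

Lemma curvatureE x v w z : curvature G x v w z =
  nabla G (cst v) (fun y => Gamma y w z) x - nabla G (cst w) (fun y => Gamma y v z) x.
Proof.
rewrite /curvature /curvature_op !nabla_cst [X in _ - X](_ : _ = 0) ?subr0 //.
have -> : bracket (cst v) (cst w) = cst 0.
  by apply/funext => y; rewrite /bracket !derive_cst subrr.
by rewrite nabla_cst christoffel_form_0l.
Qed.

(* Lowering an index leaves only second derivatives of [G] to evaluate. *)
Lemma inner_curvature x v w z u : O x ->
  << curvature G x v w z, u >>_x =
  'D_v (fun y => << Gamma y w z, u >>_y) x - 'D_w (fun y => << Gamma y v z, u >>_y) x
  - << Gamma x w z, Gamma x v u >>_x + << Gamma x v z, Gamma x w u >>_x.
Proof.
move=> Ox; rewrite curvatureE.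
have N a b := nabla_metric (G_sym_near Ox) (G_unit Ox) (cst a) (G_diff Ox)
  (christoffel_form_diff b z Ox) (@differentiable_cst _ _ _ u x).
rewrite !N !nabla_cst.
rewrite -[X in inner G x X u]addrC -scaleN1r inner_linear.
by ring.
Qed.

Lemma smooth_inner (V W : 'rV[R]_m -> 'rV[R]_m) :
    (forall j, smooth O (fun x => V x 0 j)) -> (forall j, smooth O (fun x => W x 0 j)) ->
  smooth O (fun x => << V x, W x >>_x).
Proof.
move=> sV sW.
apply: (@smooth_ext _ _ _ (fun y => \sum_i \sum_j V y 0 i * G y i j * W y 0 j)).
  by move=> y _; rewrite innerE.
by do 2![apply: smooth_sum => ?]; apply: smooth_mul => //; exact: smooth_mul.
Qed.

Lemma derive_derive_inner x v w z u : O x ->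
  'D_v (fun y => 'D_w (fun y => << z, u >>_y) y) x =
  'D_w (fun y => 'D_v (fun y => << z, u >>_y) y) x.
Proof.
move=> Ox; have sI : smooth O (fun y => << z, u >>_y).
  by apply: smooth_inner => j; exact: smooth_cst.
apply: (derive_comm O_open) => // [y Oy|a]; first exact: smooth_diff sI Oy.
by apply: (smooth_diff O_open) Ox; exact: smooth_D.
Qed.

(** By compatibility with the metric, the derivative terms of the two sides combine into
    [D_v D_w <z, u> - D_w D_v <z, u>], which vanishes by symmetry of second derivatives; the terms
    quadratic in [Gamma] cancel. *)
Lemma curvature_anti_lower x v w z u : O x ->
  << curvature G x v w z, u >>_x = - << curvature G x v w u, z >>_x.
Proof.
move=> Ox; rewrite !inner_curvature //.
have D a b : 'D_a (fun y => << Gamma y b z, u >>_y) x +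
    'D_a (fun y => << Gamma y b u, z >>_y) x =
    'D_a (fun y => 'D_b (fun y => << z, u >>_y) y) x.
  have dI c d : derivable (fun y => << Gamma y b c, d >>_y) x a.
    apply: diff_derivable; apply: smooth_diff O_open _ Ox; apply: smooth_inner => j.
      exact: smooth_christoffel_form.
    exact: smooth_cst.
  rewrite -[LHS]deriveD //; apply: near_eq_derive; apply: open_near Ox _ => // y Oy.
  by rewrite derive_inner_cst // [X in _ = _ + X]innerC.
have := derive_derive_inner v w z u Ox; rewrite -!D.
rewrite (innerC (Gamma x w u)) // (innerC (Gamma x v u)) //.
move: (derive _ x v) (derive _ x v) (derive _ x w) (derive _ x w) => a b c d.
move: (inner _ _ _ _) (inner _ _ _ _) => e f H.
move/(canRL (addrK _)) : H => ->.
ring.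
Qed.

Lemma curvature_anti x v w z : curvature G x v w z = - curvature G x w v z.
Proof. by rewrite !curvatureE opprB. Qed.

(** The connection has no torsion and constant fields commute, so the six second covariant
    derivatives cancel in pairs. *)
Lemma bianchi x v w z : O x ->
  curvature G x v w z + curvature G x w z v + curvature G x z v w = 0.
Proof.
move=> Ox; have S a b c :
    nabla G (cst a) (fun y => Gamma y b c) x = nabla G (cst a) (fun y => Gamma y c b) x.
  rewrite /nabla /= (christoffel_formC b c Ox); congr (_ + _).
  by apply: near_eq_derive; apply: open_near Ox _ => // y Oy; rewrite christoffel_formC.
rewrite !curvatureE (S v z w) (S w v z) (S z w v).
move: (nabla _ _ _ _) (nabla _ _ _ _) (nabla _ _ _ _) => a b c.
by rewrite (addrA (c - b)) subrK (addrA (c - a)) subrK subrr.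
Qed.

Lemma innerDl x v w z : << v + w, z >>_x = << v, z >>_x + << w, z >>_x.
Proof. by have := inner_linear G x 1 v w z; rewrite scale1r mul1r. Qed.

Lemma innerDr x v w z : << z, v + w >>_x = << z, v >>_x + << z, w >>_x.
Proof. by have := inner_linear_r G x 1 v w z; rewrite scale1r mul1r. Qed.

Lemma innerZl x c v w : << c *: v, w >>_x = c * << v, w >>_x.
Proof. by have := inner_linear G x c v 0 w; rewrite inner0l !addr0. Qed.

Lemma innerZr x c v w : << v, c *: w >>_x = c * << v, w >>_x.
Proof. by have := inner_linear_r G x c w 0 v; rewrite inner0r !addr0. Qed.

Lemma innerNl x v w : << - v, w >>_x = - << v, w >>_x.
Proof. by rewrite -scaleN1r innerZl mulN1r. Qed.

(** The classical argument: four instances of the Bianchi identity, brought to common entries by the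
    two antisymmetries, combine linearly to the claim. *)
Lemma curvature_pair x v w z u : O x ->
  << curvature G x v w z, u >>_x = << curvature G x z u v, w >>_x.
Proof.
move=> Ox; pose a p q r s := << curvature G x p q r, s >>_x.
have a1 p q r s : a p q r s = - a q p r s by rewrite /a curvature_anti innerNl.
have a2 p q r s : a p q r s = - a p q s r by exact: curvature_anti_lower.
have a3 p q r s : a p q r s + a q r p s + a r p q s = 0.
  by rewrite /a -!innerDl bianchi // inner0l.
rewrite -!/(a _ _ _ _); clearbody a.
have := a3 v w z u; have := a3 w z u v; have := a3 z u v w; have := a3 u v w z.
rewrite (a1 z v w u) (a2 w z u v) (a2 z u w v) (a1 u w z v) (a2 w u z v).
rewrite (a1 u v z w) (a2 v u z w) (a2 v z u w) (a1 u v w z) (a2 v w u z).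
lra.
Qed.

(** Koszul's argument: symmetry in the first two slots and the prescribed symmetrization over the
    last two determine a trilinear form, and nondegeneracy recovers the vector. This is the tool
    that identifies the connection of $g_A$ from a candidate formula given at a single point. *)
Lemma connection_unique x (C : 'rV[R]_m -> 'rV[R]_m -> 'rV[R]_m) : O x ->
    (forall v w, C v w = C w v) ->
    (forall v w z, 'D_v (fun y => << w, z >>_y) x =
       << C v w, z >>_x + << w, C v z >>_x) ->
  forall v w, christoffel_form G x v w = C v w.
Proof.
move=> Ox C_sym C_metric v w; apply/eqP; rewrite -subr_eq0; apply/eqP.
apply: (inner_nondeg Ox) => z; rewrite innerDl innerNl.
have E p q r : << Gamma x p q, r >>_x + << Gamma x p r, q >>_x =
    << C p q, r >>_x + << C p r, q >>_x.
  rewrite (innerC (Gamma x p r)) // (innerC (C p r)) //.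
  by rewrite -derive_inner_cst // C_metric.
pose k p q r := << Gamma x p q, r >>_x; pose c p q r := << C p q, r >>_x.
have k_sym p q r : k p q r = k q p r by rewrite /k christoffel_formC.
have c_sym p q r : c p q r = c q p r by rewrite /c C_sym.
rewrite -/(k _ _ _) -/(c _ _ _).
have {}E p q r : k p q r + k p r q = c p q r + c p r q := E p q r.
clearbody k c.
have := E v w z; have := E w v z; have := E z v w.
rewrite (k_sym w v) (k_sym z v) (k_sym z w) (c_sym w v) (c_sym z v) (c_sym z w).
lra.
Qed.

End MetricTheory.

(** * Derivation rules *)

Section DeriveRules.
Context {R : realType}.

Lemma is_derive_add (V : normedModType R) (f g : V -> R) (x v : V) (df dg : R) :
  is_derive x v f df -> is_derive x v g dg ->
  is_derive x v (fun y => f y + g y) (df + dg).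
Proof. exact: is_deriveD. Qed.

Lemma is_derive_mul (V : normedModType R) (f g : V -> R) (x v : V) (df dg : R) :
  is_derive x v f df -> is_derive x v g dg ->
  is_derive x v (fun y => f y * g y) (df * g x + f x * dg).
Proof.
move=> Df Dg; apply: is_derive_eq (is_deriveM Df Dg) _.
by rewrite addrC /GRing.scale /=; congr (_ + _); rewrite mulrC.
Qed.

Lemma is_derive_mx (V : normedModType R) k l (W : V -> 'M[R]_(k, l)) (dW : 'M[R]_(k, l)) (x v : V) :
  (forall i j, is_derive x v (fun y => W y i j) (dW i j)) -> is_derive x v W dW.
Proof.
move=> H; have dW' : derivable W x v by apply/derivable_mxP => i j; case: (H i j).
apply: DeriveDef => //; rewrite derive_mx //; apply/matrixP => i j; rewrite mxE.
by case: (H i j).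
Qed.

Lemma is_derive_mulmx (V : normedModType R) k l m (A : V -> 'M[R]_(k, l))
    (B : V -> 'M[R]_(l, m)) (x v : V) :
    derivable A x v -> derivable B x v ->
  is_derive x v (fun y => A y *m B y) ('D_v A x *m B x + A x *m 'D_v B x).
Proof.
move=> dA dB; apply: is_derive_mx => i j.
have -> : (fun y => (A y *m B y) i j) =
    \sum_h ((fun y => A y i h) * (fun y => B y h j)).
  by apply/funext => y; rewrite mxE fct_sumE.
have H h := is_derive_mul (is_derive_entry i h dA) (is_derive_entry h j dB).
apply: is_derive_eq (is_derive_sum H) _.
by rewrite !mxE -big_split /=.
Qed.

Lemma is_derive_trmx (V : normedModType R) k l (A : V -> 'M[R]_(k, l)) (x v : V) :
  derivable A x v -> is_derive x v (fun y => (A y)^T) ('D_v A x)^T.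
Proof.
move=> dA; apply: is_derive_mx => i j; rewrite mxE.
by under eq_fun do rewrite mxE; exact: is_derive_entry.
Qed.

Lemma is_derive_bilinear (V : normedModType R) n (A : V -> 'M[R]_n)
    (W Z : V -> 'rV[R]_n) (x v : V) :
    derivable A x v -> derivable W x v -> derivable Z x v ->
  is_derive x v (fun y => (W y *m A y *m (Z y)^T) 0 0)
    (('D_v W x *m A x *m (Z x)^T) 0 0 + (W x *m 'D_v A x *m (Z x)^T) 0 0
     + (W x *m A x *m ('D_v Z x)^T) 0 0).
Proof.
move=> dA dW dZ; have dWA := is_derive_mulmx dW dA.
have dZT := is_derive_trmx dZ.
have := is_derive_mulmx (@ex_derive _ _ _ _ _ _ _ dWA) (@ex_derive _ _ _ _ _ _ _ dZT).
rewrite !derive_val => dF.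
have := is_derive_entry 0 0 (@ex_derive _ _ _ _ _ _ _ dF); rewrite derive_val.
by rewrite mulmxDl !mxE.
Qed.

Lemma is_derive_lsubmx n (W : normedModType R) (f : 'rV[R]_n -> W)
    (z zeta : 'rV[R]_(n + n)) : differentiable f (lsubmx z) ->
  is_derive z zeta (fun z => f (lsubmx z)) ('D_(lsubmx zeta) f (lsubmx z)).
Proof.
move=> df; have dl := differentiable_lsubmx z.
have dfl := differentiable_comp dl df.
apply: DeriveDef; first exact: diff_derivable.
rewrite deriveE // [X in X _ = _](diff_comp dl df) /= deriveE // diff_lin //.
exact: continuous_lsubmx.
Qed.

Definition smooth_field m n (O : set 'rV[R]_m) (W : 'rV[R]_m -> 'rV[R]_n) :=
  forall j, smooth O (fun x => W x 0 j).

Lemma smooth_field_derivable m n (O : set 'rV[R]_m) (W : 'rV[R]_m -> 'rV[R]_n) x v :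
  open O -> O x -> smooth_field O W -> derivable W x v.
Proof.
move=> oO Ox sW; apply: derivable_row => j; apply: diff_derivable.
exact: smooth_diff oO (sW j) Ox.
Qed.

Lemma smooth_field_D m n (O : set 'rV[R]_m) (W : 'rV[R]_m -> 'rV[R]_n) v :
  open O -> smooth_field O W -> smooth_field O (fun x => 'D_v W x).
Proof.
move=> oO sW j; apply: smooth_ext (smooth_D v oO (sW j)) => x Ox.
by rewrite derive_mx ?mxE //; exact: smooth_field_derivable Ox sW.
Qed.

Lemma smooth_field_cst m n (O : set 'rV[R]_m) (w : 'rV[R]_n) : smooth_field O (fun=> w).
Proof. by move=> j; exact: smooth_cst. Qed.

Lemma smooth_field_add m n (O : set 'rV[R]_m) (V W : 'rV[R]_m -> 'rV[R]_n) :
  smooth_field O V -> smooth_field O W -> smooth_field O (fun x => V x + W x).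
Proof.
by move=> sV sW j; apply: smooth_ext (smooth_add (sV j) (sW j)) => x _; rewrite mxE.
Qed.

End DeriveRules.

Lemma posdef_unitmx (R : realType) n (G : 'rV[R]_n -> 'M[R]_n) x :
  (forall v, v != 0 -> 0 < inner G x v v) -> G x \in unitmx.
Proof.
move=> pos; rewrite -row_free_unit -kermx_eq0; apply/rowV0P => v.
rewrite sub_kermx => /eqP vG; apply/eqP/negPn/negP => /pos.
by rewrite /inner vG mul0mx mxE ltxx.
Qed.

(** * One-sided differentiability of the functions L, M and N *)

Section HalfLineExtension.
Context {R : realType}.

(** Half-line differentiability phrased through an extension derivable on both sides, so that sums,
    products and inverses inherit the ordinary rules; [hl_derivableP] translates it back into the
    limit of half-line quotients. *)
Definition hl_derivable (f : R -> R) (t : R) :=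
  exists2 g : R -> R, derivable g t 1 & forall s, 0 <= s -> g s = f s.

Lemma hl_derivableP (f : R -> R) t : 0 <= t ->
  hl_derivable f t <-> cvg (hl_quotient f t @ hl_filter t).
Proof.
move=> t0; split=> [[g dg gf]|df]; last first.
  have [d _] := hl_derive_extension t0 df.
  by exists (fun s => if 0 <= s then f s else f t + hl_derive f t * (s - t)) => // s ->.
have /cvg_ex[l gl] := dg; apply/cvg_ex; exists l.
have ? := hl_filter_proper t0.
apply/cvgrPdist_le => e e0.
have [d /= d0 dP] := (cvgrPdist_le _ _).1 gl e e0.
exists d => //= s /= sd st s0.
have := dP (s - t); rewrite /= sub0r normrN distrC => /(_ sd).
rewrite subr_eq0 => /(_ st); rewrite /shift /= [_ *: 1]mulr1 subrK !gf //.
by rewrite /hl_quotient [_ *: _]mulrC.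
Qed.

Lemma hl_derivable_cst c t : hl_derivable (fun=> c) t.
Proof. by exists (fun=> c). Qed.

Lemma hl_derivable_id t : hl_derivable id t.
Proof. by exists id. Qed.

Lemma hl_derivable_add f g t : hl_derivable f t -> hl_derivable g t ->
  hl_derivable (fun s => f s + g s) t.
Proof.
move=> [f' df ff] [g' dg gg]; exists (f' + g'); first exact: derivableD.
by move=> s s0; rewrite fctE ff // gg.
Qed.

Lemma hl_derivable_mul f g t : hl_derivable f t -> hl_derivable g t ->
  hl_derivable (fun s => f s * g s) t.
Proof.
move=> [f' df ff] [g' dg gg]; exists (f' * g'); first exact: derivableM.
by move=> s s0; rewrite fctE ff // gg.
Qed.

Lemma hl_derivable_inv f t : 0 <= t -> f t != 0 -> hl_derivable f t ->
  hl_derivable (fun s => (f s)^-1) t.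
Proof.
move=> t0 f0 [f' df ff]; exists (fun s => (f' s)^-1); last by move=> s s0; rewrite ff.
by apply: derivableV => //; rewrite ff.
Qed.

Variables a b : R -> R.
Hypothesis a_smooth : hl_smooth a.
Hypothesis b_smooth : hl_smooth b.
Hypothesis a_gt0 : forall t, 0 <= t -> 0 < a t.
Hypothesis b_ge0 : forall t, 0 <= t -> 0 <= b t.
Variable t : R.
Hypothesis t_ge0 : 0 <= t.

Lemma hl_smooth_derivable phi : hl_smooth phi -> hl_derivable phi t.
Proof. by move=> s; apply/hl_derivableP => //; exact: hl_smooth_cvg. Qed.

Lemma a_neq0 : a t != 0.
Proof. by rewrite gt_eqF // a_gt0. Qed.

Lemma a2tb_neq0 : a t + 2 * t * b t != 0.
Proof. by rewrite gt_eqF // ltr_wpDr ?a_gt0 // mulr_ge0 ?b_ge0 // mulr_ge0. Qed.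

(** This and the next two relations are the definitions of L, M and N solved for [a'], [b] and [b'].
    They are free of division, so that compatibility with the metric in a fiber becomes a polynomial
    identity. *)
Lemma hl_derive_fL : hl_derive a t = 2 * a t * fL a t.
Proof. by rewrite /fL; field; exact: a_neq0. Qed.

Lemma fM_relation : b t = fM a b t * (a t + 2 * t * b t) + a t * fL a t.
Proof.
rewrite /fM /fL; have := a_neq0; have := a2tb_neq0.
by move: (a t) (b t) (hl_derive a t) => x y x' n1 n2; field; rewrite n1 n2.
Qed.

Lemma hl_derive_fN :
  hl_derive b t = 2 * fN a b t * (a t + 2 * t * b t) + 4 * fL a t * b t.
Proof.
rewrite /fN /fL; have := a_neq0; have := a2tb_neq0.
by move: (a t) (b t) (hl_derive a t) (hl_derive b t) => x y x' y' n1 n2; field; rewrite n1 n2.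
Qed.

Let da := hl_smooth_derivable a_smooth.
Let db := hl_smooth_derivable b_smooth.
Let da' := hl_smooth_derivable (hl_smooth_derive a_smooth).
Let db' := hl_smooth_derivable (hl_smooth_derive b_smooth).

Lemma fL_cvg : cvg (hl_quotient (fL a) t @ hl_filter t).
Proof.
apply/(hl_derivableP _ t_ge0); apply: hl_derivable_mul => //.
apply: hl_derivable_inv => //; first by rewrite mulf_neq0 ?pnatr_eq0 ?a_neq0.
by apply: hl_derivable_mul => //; exact: hl_derivable_cst.
Qed.

Let da2tb : hl_derivable (fun s => a s + 2 * s * b s) t.
Proof.
apply: hl_derivable_add => //; apply: hl_derivable_mul => //.
by apply: hl_derivable_mul; [exact: hl_derivable_cst|exact: hl_derivable_id].
Qed.

Let hl_derivable_opp f : hl_derivable f t -> hl_derivable (fun s => - f s) t.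
Proof.
move=> [g dg gf]; exists (- g); first exact: derivableN.
by move=> s s0; rewrite fctE gf.
Qed.

Lemma fM_cvg : cvg (hl_quotient (fM a b) t @ hl_filter t).
Proof.
apply/(hl_derivableP _ t_ge0); apply: hl_derivable_mul.
  apply: hl_derivable_add; last exact: hl_derivable_opp.
  by apply: hl_derivable_mul => //; exact: hl_derivable_cst.
apply: hl_derivable_inv => //; first by rewrite mulf_neq0 ?pnatr_eq0 ?a2tb_neq0.
by apply: hl_derivable_mul => //; exact: hl_derivable_cst.
Qed.

(** [F1], [F2] and [F3] contain no derivative of N, but the derivative of [vertical_connection]
    does; it cancels only in the curvature, in [curvature_vv]. *)
Lemma fN_cvg : cvg (hl_quotient (fN a b) t @ hl_filter t).
Proof.
apply/(hl_derivableP _ t_ge0); apply: hl_derivable_mul.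
  apply: hl_derivable_add; first exact: hl_derivable_mul.
  apply: hl_derivable_opp; apply: hl_derivable_mul => //.
  by apply: hl_derivable_mul => //; exact: hl_derivable_cst.
apply: hl_derivable_inv => //; first by rewrite !mulf_neq0 ?pnatr_eq0 ?a_neq0 ?a2tb_neq0.
apply: hl_derivable_mul => //.
by apply: hl_derivable_mul => //; exact: hl_derivable_cst.
Qed.

End HalfLineExtension.

(** * The Levi-Civita connection of the tangent bundle *)

(** The Levi-Civita connection pulled back along the projection of the tangent bundle: [W] assigns
    to each point of the bundle a vector tangent to the base. Like the next definitions it is
    locked, so that algebraic steps treat it as an atom. *)
HB.lock Definition covariant_derivative {R : realType} {n : nat} (G : 'rV[R]_n -> 'M[R]_n)
    (zeta : 'rV[R]_(n + n)) (W : 'rV[R]_(n + n) -> 'rV[R]_n) (z : 'rV[R]_(n + n)) : 'rV[R]_n :=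
  'D_zeta W z + christoffel_form G (lsubmx z) (lsubmx zeta) (W z).

HB.lock Definition riemann {R : realType} {n : nat} (G : 'rV[R]_n -> 'M[R]_n)
    (x v w z u : 'rV[R]_n) : R := inner G x (curvature G x v w z) u.

HB.lock Definition vertical_metric {R : realType} {n : nat} (a b : R -> R)
    (G : 'rV[R]_n -> 'M[R]_n) (z : 'rV[R]_(n + n)) (v w : 'rV[R]_n) : R :=
  a (energy G z) * inner G (lsubmx z) v w
  + b (energy G z) * inner G (lsubmx z) v (rsubmx z) * inner G (lsubmx z) w (rsubmx z).

(* The derivative of [vertical_metric] along [zeta] at parallel fields. *)
HB.lock Definition vertical_metric_derivative {R : realType} {n : nat} (a b : R -> R)
    (G : 'rV[R]_n -> 'M[R]_n) (zeta z : 'rV[R]_(n + n)) (v w : 'rV[R]_n) : R :=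
  let g := inner G (lsubmx z) in let y := rsubmx z in let t := energy G z in
  let v' := vpart G z zeta in
  g v' y * hl_derive a t * g v w + g v' y * hl_derive b t * g v y * g w y
  + b t * g v v' * g w y + b t * g v y * g w v'.

(* The Levi-Civita connection of a fiber minus the flat one. *)
HB.lock Definition vertical_connection {R : realType} {n : nat} (a b : R -> R)
    (G : 'rV[R]_n -> 'M[R]_n) (z : 'rV[R]_(n + n)) (v w : 'rV[R]_n) : 'rV[R]_n :=
  let g := inner G (lsubmx z) in let y := rsubmx z in let t := energy G z in
  fL a t *: (g v y *: w + g w y *: v)
  + (fM a b t * g v w + fN a b t * g v y * g w y) *: y.

(** Horizontal component of the Levi-Civita connection of $g_A$ on constant coordinate fields. Its
    curvature terms are forced by the one in [connection_ver], through compatibility with the metric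
    and the pair symmetry of the curvature. *)
HB.lock Definition connection_hor {R : realType} {n : nat} (a : R -> R)
    (G : 'rV[R]_n -> 'M[R]_n) (z zeta xi : 'rV[R]_(n + n)) : 'rV[R]_n :=
  christoffel_form G (lsubmx z) (lsubmx zeta) (lsubmx xi) + (a (energy G z) / 2) *:
    (curvature G (lsubmx z) (rsubmx z) (vpart G z xi) (lsubmx zeta)
     + curvature G (lsubmx z) (rsubmx z) (vpart G z zeta) (lsubmx xi)).

(** Vertical component. Exchanging [zeta] and [xi] changes the covariant derivative by the curvature
    term of [curvature_vpart], so subtracting half of that term makes the formula symmetric. *)
HB.lock Definition connection_ver {R : realType} {n : nat} (a b : R -> R)
    (G : 'rV[R]_n -> 'M[R]_n) (z zeta xi : 'rV[R]_(n + n)) : 'rV[R]_n :=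
  covariant_derivative G zeta (fun z => vpart G z xi) z
  + (- 2^-1) *: curvature G (lsubmx z) (lsubmx zeta) (lsubmx xi) (rsubmx z)
  + vertical_connection a b G z (vpart G z zeta) (vpart G z xi).

Section TangentBundle.
Context {R : realType} {n : nat}.
Variables (G : 'rV[R]_n -> 'M[R]_n) (U : set 'rV[R]_n) (a b : R -> R).
Hypothesis U_open : open U.
Hypothesis G_smooth : forall i j, smooth U (fun x => G x i j).
Hypothesis G_sym : forall x, U x -> (G x)^T = G x.
Hypothesis G_pos : forall x, U x -> forall v, v != 0 -> 0 < inner G x v v.
Hypothesis a_smooth : hl_smooth a.
Hypothesis b_smooth : hl_smooth b.
Hypothesis a_gt0 : forall t, 0 <= t -> 0 < a t.
Hypothesis b_ge0 : forall t, 0 <= t -> 0 <= b t.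
Implicit Types (x p v w : 'rV[R]_n) (z zeta xi eta : 'rV[R]_(n + n)).

Let O : set 'rV[R]_(n + n) := lsubmx @^-1` U.
Local Notation Gamma := (christoffel_form G).
Local Notation "<< v , w >>_ x" := (inner G x v w) (x at level 8).
Local Notation GA := (gA_gram a b G).
Local Notation hor z := (lsubmx z).
Local Notation ver z := (rsubmx z).
Local Notation cov := (covariant_derivative G).
Local Notation Rm := (riemann G).
Local Notation vinner := (vertical_metric a b G).
Local Notation dvinner := (vertical_metric_derivative a b G).
Local Notation vconn := (vertical_connection a b G).
Local Notation conn_hor := (connection_hor a G).
Local Notation conn_ver := (connection_ver a b G).

Lemma preimage_lsubmx_open : open O.
Proof. by apply: open_comp => // z _; exact: continuous_lsubmx. Qed.
Let O_open := preimage_lsubmx_open.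

Lemma base_unit x : U x -> G x \in unitmx.
Proof. by move=> Ux; apply: posdef_unitmx; exact: G_pos. Qed.
Let G_unit := base_unit.

Lemma inner_ge0 x v : U x -> 0 <= << v, v >>_x.
Proof.
move=> Ux; have [->|v0] := eqVneq v 0; first by rewrite inner0l.
by rewrite ltW // G_pos.
Qed.

Lemma energy_ge0 z : O z -> 0 <= energy G z.
Proof. by move=> Oz; rewrite mulr_ge0 ?inner_ge0 // invr_ge0. Qed.

Lemma smooth_field_ver : smooth_field O (fun z => ver z).
Proof. by move=> j; apply: smooth_ext (smooth_coord _ (rshift n j)) => z _; rewrite mxE. Qed.

Lemma smooth_field_christoffel (V W : 'rV[R]_(n + n) -> 'rV[R]_n) :
  smooth_field O V -> smooth_field O W -> smooth_field O (fun z => Gamma (hor z) (V z) (W z)).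
Proof.
move=> sV sW k.
apply: (@smooth_ext _ _ _ (fun z => \sum_i \sum_j V z 0 i * W z 0 j * christoffel G k i j (hor z))).
  by move=> z _; rewrite /christoffel_form mxE.
do 2![apply: smooth_sum => ?]; apply: smooth_mul; first exact: smooth_mul.
by apply: (smooth_lsubmx U_open); exact: smooth_christoffel.
Qed.

Lemma smooth_base_inner (V W : 'rV[R]_(n + n) -> 'rV[R]_n) :
  smooth_field O V -> smooth_field O W -> smooth O (fun z => << V z, W z >>_(hor z)).
Proof.
move=> sV sW.
apply: (@smooth_ext _ _ _ (fun z => \sum_i \sum_j V z 0 i * G (hor z) i j * W z 0 j)).
  by move=> z _; rewrite innerE.
do 2![apply: smooth_sum => ?]; apply: smooth_mul => //; apply: smooth_mul => //.
exact: (smooth_lsubmx U_open (G_smooth _ _)).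
Qed.

Lemma smooth_field_vpart (X : 'rV[R]_(n + n) -> 'rV[R]_(n + n)) :
  smooth_field O X -> smooth_field O (fun z => vpart G z (X z)).
Proof.
move=> sX; rewrite /vpart; apply: smooth_field_add.
  by move=> j; apply: smooth_ext (sX (rshift n j)) => z _; rewrite mxE.
apply: smooth_field_christoffel; last exact: smooth_field_ver.
by move=> j; apply: smooth_ext (sX (lshift n j)) => z _; rewrite mxE.
Qed.

Lemma smooth_field_vpart_cst xi : smooth_field O (fun z => vpart G z xi).
Proof. by apply: smooth_field_vpart; exact: smooth_field_cst. Qed.

Lemma smooth_energy : smooth O (energy G).
Proof. by apply: smooth_scale; apply: smooth_base_inner; exact: smooth_field_ver. Qed.

Lemma gA_formC z xi eta : O z -> gA_form a b G z xi eta = gA_form a b G z eta xi.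
Proof.
move=> Oz; rewrite /gA_form (innerC G_sym (hor xi)) // (innerC G_sym (vpart G z xi)) //.
by congr (_ + _); rewrite mulrAC.
Qed.

Lemma gA_sym z : O z -> (GA z)^T = GA z.
Proof. by move=> Oz; apply/matrixP => i j; rewrite !mxE gA_formC. Qed.

Lemma gA_pos z : O z -> forall xi, xi != 0 -> 0 < inner GA z xi xi.
Proof.
move=> Oz xi xi0; rewrite gA_gramE /gA_form -mulrA -expr2.
have a0 := a_gt0 (energy_ge0 Oz); have b0 := b_ge0 (energy_ge0 Oz).
apply: ltr_wpDr; first by rewrite mulr_ge0 // sqr_ge0.
have [h0|h0] := eqVneq (hor xi) 0; last first.
  by rewrite ltr_wpDr ?G_pos // mulr_ge0 ?inner_ge0 // ltW.
rewrite h0 inner0l add0r mulr_gt0 // G_pos //.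
apply: contra_neq xi0 => v0.
rewrite (hlift_vlift_split G z xi) h0 v0 /hlift_coord /vlift_coord.
rewrite christoffel_form_0l oppr0 add_row_mx !addr0.
by rewrite row_mx0.
Qed.

Lemma gA_unit z : O z -> GA z \in unitmx.
Proof. by move=> Oz; apply: posdef_unitmx; exact: gA_pos. Qed.

Lemma gA_smooth i j : smooth O (fun z => GA z i j).
Proof.
apply: (@smooth_ext _ _ _ (fun z => gA_form a b G z (delta_mx 0 i) (delta_mx 0 j))).
  by move=> z _; rewrite mxE.
have sv := smooth_field_vpart_cst; have sy := smooth_field_ver.
apply: smooth_add; [apply: smooth_add|].
- by apply: smooth_base_inner; exact: smooth_field_cst.
- apply: smooth_mul; last exact: smooth_base_inner.
  exact: smooth_hl a_smooth energy_ge0 smooth_energy.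
- apply: smooth_mul; last exact: smooth_base_inner.
  apply: smooth_mul; last exact: smooth_base_inner.
  exact: smooth_hl b_smooth energy_ge0 smooth_energy.
Qed.

Lemma smooth_field_cov zeta W : smooth_field O W -> smooth_field O (cov zeta W).
Proof.
move=> sW; rewrite covariant_derivative.unlock.
apply: smooth_field_add; first exact: smooth_field_D.
by apply: smooth_field_christoffel => //; exact: smooth_field_cst.
Qed.

Lemma cov_cst zeta w z : cov zeta (fun=> w) z = Gamma (hor z) (hor zeta) w.
Proof. by rewrite covariant_derivative.unlock derive_cst add0r. Qed.

(** The tautological section, whose value at $(p,\mathtt{u})$ is $\mathtt{u}$: its covariant
    derivative measures the failure of [zeta] to be horizontal. *)
Lemma cov_ver zeta z : cov zeta (fun z => ver z) z = vpart G z zeta.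
Proof.
rewrite covariant_derivative.unlock /vpart; congr (_ + _).
rewrite deriveE; last exact: differentiable_rsubmx.
by rewrite diff_lin //; exact: continuous_rsubmx.
Qed.

Lemma is_derive_inner zeta (W Z : 'rV[R]_(n + n) -> 'rV[R]_n) z :
    O z -> smooth_field O W -> smooth_field O Z ->
  is_derive z zeta (fun z => << W z, Z z >>_(hor z))
    (<< cov zeta W z, Z z >>_(hor z) + << W z, cov zeta Z z >>_(hor z)).
Proof.
move=> Oz sW sZ.
have dG : differentiable G (hor z) by exact: (G_diff U_open G_smooth).
have [dGz DGz] := is_derive_lsubmx zeta dG.
have dW := smooth_field_derivable (v := zeta) O_open Oz sW.
have dZ := smooth_field_derivable (v := zeta) O_open Oz sZ.
apply: is_derive_eq (is_derive_bilinear dGz dW dZ) _.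
(* Freezing the values of [W] and [Z] isolates the term that contains the derivative of [G];
   compatibility with the metric on the base evaluates it. *)
have := derive_inner_cst U_open G_smooth G_sym G_unit (hor zeta) (W z) (Z z) Oz.
have := is_derive_bilinear (diff_derivable (v := hor zeta) dG)
  (@derivable_cst _ _ _ (W z) (hor z) (hor zeta)) (@derivable_cst _ _ _ (Z z) (hor z) (hor zeta)).
move=> [_ ->]; rewrite !derive_cst trmx0 mulmx0 !mul0mx ![(0 : 'M[R]_1) _ _]mxE add0r addr0 => E.
rewrite DGz E covariant_derivative.unlock innerDl innerDr -/(inner G (hor z) ('D_zeta W z) (Z z)).
rewrite -/(inner G (hor z) (W z) ('D_zeta Z z)).
by move: (inner _ _ _ _) (inner _ _ _ _) (inner _ _ _ _) (inner _ _ _ _) => *; ring.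
Qed.

Lemma is_derive_christoffel zeta v (W : 'rV[R]_(n + n) -> 'rV[R]_n) z :
    O z -> smooth_field O W ->
  is_derive z zeta (fun z => Gamma (hor z) v (W z))
    ('D_(hor zeta) (fun x => Gamma x v (W z)) (hor z) + Gamma (hor z) v ('D_zeta W z)).
Proof.
move=> Oz sW; have dW := smooth_field_derivable (v := zeta) O_open Oz sW.
(* With [v] fixed, [Gamma] is the product of a row vector and a matrix field on the base, so the
   product rule for matrices separates the two dependences on [z]. *)
pose T x : 'M[R]_n := \matrix_(j, k) \sum_i v 0 i * christoffel G k i j x.
have TE x w : Gamma x v w = w *m T x.
  apply/rowP => k; rewrite !mxE exchange_big; apply: eq_bigr => j _.
  by rewrite mxE big_distrr; apply: eq_bigr => i _ /=; ring.
have dT : differentiable T (hor z).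
  apply: differentiable_mx => j k.
  apply: (smooth_diff U_open) Oz.
  apply: (@smooth_ext _ _ _ (fun x => \sum_i v 0 i * christoffel G k i j x)).
    by move=> x _; rewrite mxE.
  by apply: smooth_sum => i; apply: smooth_scale; exact: smooth_christoffel.
have [dTz DTz] := is_derive_lsubmx zeta dT.
have -> : (fun z => Gamma (hor z) v (W z)) = (fun z => W z *m T (hor z)).
  by apply/funext => z'; exact: TE.
apply: is_derive_eq (is_derive_mulmx dW dTz) _.
have -> : (fun x => Gamma x v (W z)) = (fun x => W z *m T x).
  by apply/funext => x; exact: TE.
have [_ ->] := is_derive_mulmx (@derivable_cst _ _ _ (W z) (hor z) (hor zeta))
  (diff_derivable (v := hor zeta) dT).
by rewrite derive_cst mul0mx add0r DTz TE addrC.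
Qed.

Lemma christoffel_formDr x v w w' : Gamma x v (w + w') = Gamma x v w + Gamma x v w'.
Proof. by have := (christoffel_form_bilinear G x 1).2 v w w'; rewrite !scale1r. Qed.

(** By [cov_ver], [vpart G z xi] is the covariant derivative of the tautological section along [xi].
    The right-hand side is thus the curvature of the pulled-back connection on that section, without
    bracket term because constant fields commute. *)
Lemma curvature_vpart zeta xi z : O z ->
  curvature G (hor z) (hor zeta) (hor xi) (ver z) =
  cov zeta (fun z => vpart G z xi) z - cov xi (fun z => vpart G z zeta) z.
Proof.
move=> Oz.
have D s r : cov s (fun z => vpart G z r) z =
    'D_(hor s) (fun x => Gamma x (hor r) (ver z)) (hor z)
    + Gamma (hor z) (hor r) (ver s) + Gamma (hor z) (hor s) (ver r)
    + Gamma (hor z) (hor s) (Gamma (hor z) (hor r) (ver z)).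
  have [d1 D1] := is_derive_christoffel s (hor r) Oz smooth_field_ver.
  have D2 : 'D_s (fun z : 'rV[R]_(n + n) => ver z) z = ver s.
    rewrite deriveE; last exact: differentiable_rsubmx.
    by rewrite diff_lin //; exact: continuous_rsubmx.
  rewrite covariant_derivative.unlock /vpart [X in X + _](_ : _ =
      'D_(hor s) (fun x => Gamma x (hor r) (ver z)) (hor z)
      + Gamma (hor z) (hor r) (ver s)).
    by rewrite christoffel_formDr !addrA.
  rewrite [LHS]deriveD; [|exact: derivable_cst|exact: d1].
  by rewrite derive_cst add0r D1 D2.
rewrite !D curvatureE /nabla /=.
move: (derive _ _ _) (derive _ _ _) => d1 d2.
move: (Gamma _ _ (Gamma _ _ _)) (Gamma _ _ (Gamma _ _ _)) => g1 g2.
move: (Gamma _ _ _) (Gamma _ _ _) => g3 g4.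
by apply/rowP => k; rewrite !mxE; ring.
Qed.

Lemma is_derive_energy zeta z : O z ->
  is_derive z zeta (energy G) << vpart G z zeta, ver z >>_(hor z).
Proof.
move=> Oz; have D := is_derive_inner zeta Oz smooth_field_ver smooth_field_ver.
apply: is_derive_eq (is_derive_mul (is_derive_cst (2^-1 : R) z zeta) D) _.
rewrite mul0r add0r cov_ver (innerC G_sym (ver z)) // /cst.
by move: (inner _ _ _ _) => c; field.
Qed.

Lemma is_derive_hl_energy phi zeta z : O z ->
    cvg (hl_quotient phi (energy G z) @ hl_filter (energy G z)) ->
  is_derive z zeta (fun z => phi (energy G z))
    (hl_derive phi (energy G z) * << vpart G z zeta, ver z >>_(hor z)).
Proof.
move=> Oz cphi; apply: (hl_is_derive _ _ (is_derive_energy zeta Oz) cphi).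
  exact: open_near O_open Oz energy_ge0.
exact: smooth_diff O_open smooth_energy Oz.
Qed.

Lemma riemann_anti (x v w p q : 'rV[R]_n) : Rm x v w p q = - Rm x w v p q.
Proof. by rewrite riemann.unlock curvature_anti innerNl. Qed.

Lemma riemann_anti_lower (x v w p q : 'rV[R]_n) : U x -> Rm x v w p q = - Rm x v w q p.
Proof. by move=> Ux; rewrite riemann.unlock; exact: (curvature_anti_lower U_open G_smooth). Qed.

Lemma riemann_pair (x v w p q : 'rV[R]_n) : U x -> Rm x v w p q = Rm x p q v w.
Proof. by move=> Ux; rewrite riemann.unlock; exact: (curvature_pair U_open G_smooth). Qed.

Lemma gA_vinner z xi eta :
  inner GA z xi eta = << hor xi, hor eta >>_(hor z) + vinner z (vpart G z xi) (vpart G z eta).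
Proof. by rewrite gA_gramE /gA_form vertical_metric.unlock addrA. Qed.

Lemma is_derive_vinner zeta V W z : O z -> smooth_field O V -> smooth_field O W ->
  is_derive z zeta (fun z => vinner z (V z) (W z))
    (vinner z (cov zeta V z) (W z) + vinner z (V z) (cov zeta W z)
     + dvinner zeta z (V z) (W z)).
Proof.
move=> Oz sV sW.
have Da := is_derive_hl_energy zeta Oz (hl_smooth_cvg a_smooth (energy_ge0 Oz)).
have Db := is_derive_hl_energy zeta Oz (hl_smooth_cvg b_smooth (energy_ge0 Oz)).
have DVW := is_derive_inner zeta Oz sV sW.
have DV := is_derive_inner zeta Oz sV smooth_field_ver.
have DW := is_derive_inner zeta Oz sW smooth_field_ver.
rewrite {1}vertical_metric.unlock.
have := is_derive_add (is_derive_mul Da DVW) (is_derive_mul (is_derive_mul Db DV) DW).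
move/is_derive_eq; apply; rewrite cov_ver.
rewrite vertical_metric_derivative.unlock vertical_metric.unlock /=.
move: (inner _ _ _ _) => c1.
move: (inner _ _ _ _) (inner _ _ _ _) (inner _ _ _ _) (inner _ _ _ _) => c2 c3 c4 c5.
move: (inner _ _ _ _) (inner _ _ _ _) => c6 c7.
move: (inner _ _ _ _) (inner _ _ _ _) (inner _ _ _ _) => c8 c9 c10.
by move: (a _) (b _) (hl_derive _ _) (hl_derive _ _) => *; ring.
Qed.

Lemma vinnerC z v w : O z -> vinner z v w = vinner z w v.
Proof. by move=> Oz; rewrite vertical_metric.unlock (innerC G_sym v) // mulrAC. Qed.

Lemma vinnerDl z v v' w : vinner z (v + v') w = vinner z v w + vinner z v' w.
Proof.
rewrite vertical_metric.unlock !innerDl.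
by move: (inner _ _ _ _) (inner _ _ _ _) (inner _ _ _ _) (inner _ _ _ _) (inner _ _ _ _) => *; ring.
Qed.

Lemma vinnerZl z c v w : vinner z (c *: v) w = c * vinner z v w.
Proof.
rewrite vertical_metric.unlock !innerZl.
by move: (inner _ _ _ _) (inner _ _ _ _) (inner _ _ _ _) => *; ring.
Qed.

Lemma vinner0l z w : vinner z 0 w = 0.
Proof. by have := vinnerZl z 0 0 w; rewrite scale0r mul0r. Qed.

Lemma vinnerDr z v w w' : O z -> vinner z v (w + w') = vinner z v w + vinner z v w'.
Proof. by move=> Oz; rewrite !(vinnerC v) // vinnerDl. Qed.

Lemma vinnerZr z c v w : O z -> vinner z v (c *: w) = c * vinner z v w.
Proof. by move=> Oz; rewrite !(vinnerC v) // vinnerZl. Qed.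

Lemma vinner0r z v : O z -> vinner z v 0 = 0.
Proof. by move=> Oz; rewrite vinnerC // vinner0l. Qed.

Lemma inner_ver z : << ver z, ver z >>_(hor z) = 2 * energy G z.
Proof. by rewrite /energy mulrA mulfV ?pnatr_eq0 // mul1r. Qed.

Lemma vconnC z v w : O z -> vconn z v w = vconn z w v.
Proof.
move=> Oz; rewrite vertical_connection.unlock /= (innerC G_sym v w) // [_ *: w + _]addrC.
by rewrite [_ * << v, ver z >>_(hor z) * _]mulrAC.
Qed.

Lemma vconn0 z v : vconn z 0 v = 0.
Proof.
rewrite vertical_connection.unlock /= !inner0l !scale0r scaler0 addr0 scaler0.
by rewrite !mulr0 mul0r addr0 scale0r addr0.
Qed.

Lemma inner_vconn z v w x : O z -> << vconn z v w, x >>_(hor z) =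
  fL a (energy G z) * (<< v, ver z >>_(hor z) * << w, x >>_(hor z)
     + << w, ver z >>_(hor z) * << v, x >>_(hor z))
  + (fM a b (energy G z) * << v, w >>_(hor z)
     + fN a b (energy G z) * << v, ver z >>_(hor z) * << w, ver z >>_(hor z))
    * << x, ver z >>_(hor z).
Proof.
by move=> Oz; rewrite vertical_connection.unlock /= !(innerDl, innerZl) (innerC G_sym (ver z) x).
Qed.

(** Compatibility with the metric inside a fiber. Once [a'] and [b'] are expressed through L and N,
    the two sides differ by a multiple of [fM_relation]. *)
Lemma vconn_metric z zeta v w : O z ->
  vinner z (vconn z (vpart G z zeta) v) w + vinner z v (vconn z (vpart G z zeta) w)
  = dvinner zeta z v w.
Proof.
move=> Oz; rewrite (vinnerC v) // vertical_metric.unlock.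
rewrite vertical_metric_derivative.unlock /= !inner_vconn // !inner_ver.
have := energy_ge0 Oz; move: (energy G z) => t t0.
rewrite (innerC G_sym w v) // (innerC G_sym v (vpart G z zeta)) //.
rewrite (innerC G_sym w (vpart G z zeta)) //.
rewrite (hl_derive_fL a_gt0 t0) (hl_derive_fN a_gt0 b_ge0 t0).
have := fM_relation a_gt0 b_ge0 t0.
move: (inner _ _ _ _) => c1.
move: (inner _ _ _ _) (inner _ _ _ _) (inner _ _ _ _) (inner _ _ _ _) => c2 c3 c4 c5.
move: (inner _ _ _ _) => c6.
move: (a t) (b t) (fL a t) (fM a b t) (fN a b t) => at_ bt L M N H.
apply/eqP; rewrite -subr_eq0; apply/eqP.
transitivity ((c2 * c6 + c3 * c4) * (M * (at_ + 2 * t * bt) + at_ * L - bt)); first ring.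
by rewrite -H subrr mulr0.
Qed.

(** The term with [b] drops out because $R_{vw}\mathtt{u}$ is orthogonal to $\mathtt{u}$. *)
Lemma vinner_curvature z v w x : O z ->
  vinner z (curvature G (hor z) v w (ver z)) x = a (energy G z) * Rm (hor z) v w (ver z) x.
Proof.
move=> Oz; rewrite vertical_metric.unlock.
have -> : << curvature G (hor z) v w (ver z), ver z >>_(hor z) = 0.
  have := riemann_anti_lower v w (ver z) (ver z) Oz; rewrite riemann.unlock.
  by move: (inner _ _ _ _) => c; lra.
by rewrite mulr0 mul0r addr0 riemann.unlock.
Qed.

Lemma hor_lift z h v : hor (hlift_coord G z h + vlift_coord v) = h.
Proof. by rewrite linearD /= !row_mxKl addr0. Qed.

Lemma vpart_lift z h v : vpart G z (hlift_coord G z h + vlift_coord v) = v.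
Proof.
have := vpart_linear G z 1 (hlift_coord G z h) (vlift_coord v).
by rewrite !scale1r vpart_hlift vpart_vlift add0r.
Qed.

Lemma inner_conn_hor z zeta xi w : << conn_hor z zeta xi, w >>_(hor z) =
  << Gamma (hor z) (hor zeta) (hor xi), w >>_(hor z) + a (energy G z) / 2 *
    (Rm (hor z) (ver z) (vpart G z xi) (hor zeta) w
     + Rm (hor z) (ver z) (vpart G z zeta) (hor xi) w).
Proof.
rewrite connection_hor.unlock riemann.unlock.
move: (Gamma _ _ _) (curvature _ _ _ _ _) (curvature _ _ _ _ _) => v1 v2 v3.
by rewrite innerDl innerZl innerDl.
Qed.

Lemma vinner_conn_ver z zeta xi w : O z -> vinner z (conn_ver z zeta xi) w =
  vinner z (cov zeta (fun z => vpart G z xi) z) w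
  - 2^-1 * (a (energy G z) * Rm (hor z) (hor zeta) (hor xi) (ver z) w)
  + vinner z (vconn z (vpart G z zeta) (vpart G z xi)) w.
Proof.
move=> Oz; rewrite connection_ver.unlock -(vinner_curvature _ _ _ Oz).
move: (cov _ _ _) (curvature _ _ _ _ _) (vconn _ _ _) => v1 v2 v3.
by rewrite 2!vinnerDl vinnerZl mulNr.
Qed.

Lemma conn_horC z zeta xi : O z -> conn_hor z zeta xi = conn_hor z xi zeta.
Proof.
move=> Oz; rewrite connection_hor.unlock (christoffel_formC U_open G_sym _ _ Oz).
by rewrite [curvature _ _ _ (vpart G z xi) _ + _]addrC.
Qed.

Lemma conn_verC z zeta xi : O z -> conn_ver z zeta xi = conn_ver z xi zeta.
Proof.
move=> Oz; rewrite connection_ver.unlock (vconnC _ _ Oz) (curvature_anti G (hor z) (hor xi)).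
rewrite !(curvature_vpart _ _ Oz).
by move: (cov _ _ _) (cov _ _ _) (vconn _ _ _) => c d e; apply/rowP => k; rewrite !mxE; field.
Qed.

Definition conn z zeta xi : 'rV[R]_(n + n) :=
  hlift_coord G z (conn_hor z zeta xi) + vlift_coord (conn_ver z zeta xi).

Lemma connC z zeta xi : O z -> conn z zeta xi = conn z xi zeta.
Proof. by move=> Oz; rewrite /conn (conn_horC _ _ Oz) (conn_verC _ _ Oz). Qed.

(** On the base [Gamma] is compatible with g, and in the fibers [cov] together with [vconn] is
    compatible with the vertical metric. The remaining curvature terms cancel: two pairs match by
    pair symmetry, the last pair by antisymmetry. *)
Lemma conn_metric (z v w x : 'rV[R]_(n + n)) : O z ->
  'D_v (fun y => inner GA y w x) z =
  inner GA z (conn z v w) x + inner GA z w (conn z v x).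
Proof.
move=> Oz.
have D := is_derive_inner v Oz (smooth_field_cst O (hor w)) (smooth_field_cst O (hor x)).
have E := is_derive_vinner v Oz (smooth_field_vpart_cst w) (smooth_field_vpart_cst x).
have -> : (fun y => inner GA y w x) = (fun z => << hor w, hor x >>_(hor z)
    + vinner z (vpart G z w) (vpart G z x)).
  by apply/funext => y; exact: gA_vinner.
have [_ ->] := is_derive_add D E.
rewrite (gA_vinner _ (conn _ _ _)) (gA_vinner _ _ (conn _ _ _)) /conn.
rewrite !hor_lift.
rewrite !vpart_lift.
rewrite !cov_cst.
rewrite (innerC G_sym (hor w) (conn_hor _ _ _) Oz).
rewrite (vinnerC (vpart G z w) (conn_ver _ _ _) Oz).
rewrite !inner_conn_hor.
rewrite !(vinner_conn_ver _ _ _ Oz).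
rewrite -(vconn_metric _ _ _ Oz).
rewrite (riemann_pair (hor v) (hor w) _ _ Oz) (riemann_pair (hor v) (hor x) _ _ Oz).
rewrite (riemann_anti_lower (ver z) (vpart G z v) (hor w) (hor x) Oz).
rewrite (innerC G_sym (hor w) (Gamma _ _ _) Oz).
rewrite (vinnerC (vpart G z w) (cov _ _ _) Oz) (vinnerC (vpart G z w) (vconn _ _ _) Oz).
move: (Rm _ _ _ _ _) (Rm _ _ _ _ _) (Rm _ _ _ _ _) => r1 r2 r3.
move: (vinner _ _ _) (vinner _ _ _) (vinner _ _ _) (vinner _ _ _) => d1 d2 d3 d4.
by move: (inner _ _ _ _) (inner _ _ _ _) (a _) => c1 c2 a0; field.
Qed.

Lemma connection_gA z zeta xi : O z -> christoffel_form GA z zeta xi = conn z zeta xi.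
Proof.
move=> Oz.
apply: (connection_unique O_open gA_smooth gA_sym gA_unit Oz) => *; first exact: connC.
exact: conn_metric.
Qed.

(** * Curvature of the tangent bundle *)

Lemma riemann0 (x v p q : 'rV[R]_n) : U x -> Rm x 0 v p q = 0.
Proof.
move=> Ux; rewrite (riemann_pair _ _ _ _ Ux) (riemann_anti_lower _ _ _ _ Ux).
by rewrite riemann.unlock inner0r oppr0.
Qed.

Lemma riemann_alt (x v p q : 'rV[R]_n) : Rm x v v p q = 0.
Proof. by have := riemann_anti x v v p q; move: (Rm _ _ _ _ _) => c; lra. Qed.

Lemma curvature0 (x v p : 'rV[R]_n) : U x -> curvature G x v 0 p = 0.
Proof.
move=> Ux; apply: (inner_nondeg G_unit Ux) => w.
have := riemann_anti x v 0 p w; rewrite (riemann0 _ _ _ Ux) riemann.unlock => ->.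
by rewrite oppr0.
Qed.

(** Pair symmetry turns the curvature terms of the horizontal component into $R\mathtt{u}$ paired
    with a vertical part, the shape that [is_derive_riemann_vpart] differentiates. *)
Lemma inner_connection z zeta xi eta : O z ->
  inner GA z (christoffel_form GA z zeta xi) eta =
  << Gamma (hor z) (hor zeta) (hor xi), hor eta >>_(hor z)
  + 2^-1 * (a (energy G z) * Rm (hor z) (hor zeta) (hor eta) (ver z) (vpart G z xi)
            + a (energy G z) * Rm (hor z) (hor xi) (hor eta) (ver z) (vpart G z zeta))
  + vinner z (conn_ver z zeta xi) (vpart G z eta).
Proof.
move=> Oz; rewrite (connection_gA _ _ Oz) gA_vinner /conn hor_lift vpart_lift.
rewrite inner_conn_hor (riemann_pair (ver z) (vpart G z xi) _ _ Oz).
rewrite (riemann_pair (ver z) (vpart G z zeta) _ _ Oz).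
move: (Rm _ _ _ _ _) (Rm _ _ _ _ _) (vinner _ _ _) (inner _ _ _ _) (a _) => *.
by field.
Qed.

(** Agrees with [conn_ver] on [O], but is written with the Christoffel symbols of $g_A$, from which
    its smoothness is immediate. *)
Definition conn_field zeta xi z : 'rV[R]_n := vpart G z (christoffel_form GA z zeta xi).

Lemma conn_fieldE z zeta xi : O z -> conn_field zeta xi z = conn_ver z zeta xi.
Proof. by move=> Oz; rewrite /conn_field (connection_gA _ _ Oz) /conn vpart_lift. Qed.

Lemma smooth_conn_field zeta xi : smooth_field O (conn_field zeta xi).
Proof.
apply: smooth_field_vpart => j.
exact: (smooth_christoffel_form O_open gA_smooth gA_unit).
Qed.

Lemma dvinner0 zeta z v : dvinner zeta z v 0 = 0.
Proof. by rewrite vertical_metric_derivative.unlock /= !inner0l inner0r !mulr0 !addr0. Qed.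

(** The second argument vanishes at [z], so in the product rule only the term that differentiates it
    survives. *)
Lemma is_derive_vinner_vpart zeta xi (V : 'rV[R]_(n + n) -> 'rV[R]_n) z :
    O z -> smooth_field O V -> vpart G z xi = 0 ->
  is_derive z zeta (fun z => vinner z (V z) (vpart G z xi))
    (vinner z (V z) (cov zeta (fun z => vpart G z xi) z)).
Proof.
move=> Oz sV xi0; apply: is_derive_eq (is_derive_vinner zeta Oz sV (smooth_field_vpart_cst xi)) _.
by rewrite xi0 (vinner0r _ Oz) dvinner0 add0r addr0.
Qed.

Lemma is_derive_riemann_vpart zeta z v w eta : O z -> vpart G z eta = 0 ->
  is_derive z zeta (fun z => a (energy G z) * Rm (hor z) v w (ver z) (vpart G z eta))
    (a (energy G z) * Rm (hor z) v w (ver z) (cov zeta (fun z => vpart G z eta) z)).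
Proof.
move=> Oz eta0.
(* Constant fields projecting to [v] and [w]. Through [curvature_vpart] they present
   $R_{vw}\mathtt{u}$ as a smooth field [V], which reduces the claim to [is_derive_vinner_vpart]. *)
pose e1 : 'rV[R]_(n + n) := row_mx v 0; pose e2 : 'rV[R]_(n + n) := row_mx w 0.
pose V z := cov e1 (fun z => vpart G z e2) z + (-1) *: cov e2 (fun z => vpart G z e1) z.
have VE z' : O z' -> curvature G (hor z') v w (ver z') = V z'.
  move=> Oz'; have := curvature_vpart e1 e2 Oz'.
  by rewrite /V scaleN1r /e1 /e2 !row_mxKl.
have sV : smooth_field O V.
  apply: smooth_field_add; first by apply: smooth_field_cov; exact: smooth_field_vpart_cst.
  have s1 := smooth_field_cov e2 (smooth_field_vpart_cst e1).
  move=> j; apply: smooth_ext (smooth_scale (-1) (s1 j)) => z' _.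
  by rewrite mxE.
have := is_derive_vinner_vpart zeta Oz sV eta0; rewrite -(VE _ Oz) (vinner_curvature _ _ _ Oz).
apply: near_eq_is_derive; apply: (open_near O_open Oz) => z' Oz'.
by rewrite -(VE _ Oz') (vinner_curvature _ _ _ Oz').
Qed.

Lemma gA_inner_curvature z xi eta : O z ->
  inner GA z (curvature GA z xi eta eta) xi =
  'D_xi (fun z => inner GA z (christoffel_form GA z eta eta) xi) z
  - 'D_eta (fun z => inner GA z (christoffel_form GA z xi eta) xi) z
  - inner GA z (christoffel_form GA z eta eta) (christoffel_form GA z xi xi)
  + inner GA z (christoffel_form GA z xi eta) (christoffel_form GA z xi eta).
Proof.
move=> Oz; rewrite (inner_curvature O_open gA_smooth gA_sym gA_unit _ _ _ _ Oz).
by rewrite (christoffel_formC O_open gA_sym eta xi Oz).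
Qed.

Lemma curvature_alt (x v p : 'rV[R]_n) : U x -> curvature G x v v p = 0.
Proof.
move=> Ux; apply: (inner_nondeg G_unit Ux) => w.
by have := riemann_alt x v p w; rewrite riemann.unlock.
Qed.

Lemma conn_hor_hlift z zeta xi : O z -> vpart G z zeta = 0 -> vpart G z xi = 0 ->
  conn_hor z zeta xi = Gamma (hor z) (hor zeta) (hor xi).
Proof.
move=> Oz zeta0 xi0; rewrite connection_hor.unlock zeta0 xi0 !(curvature0 _ _ Oz).
by rewrite addr0 scaler0 addr0.
Qed.

Lemma conn_ver_hlift z zeta xi : vpart G z zeta = 0 ->
  conn_ver z zeta xi = cov zeta (fun z => vpart G z xi) z
    + (- 2^-1) *: curvature G (hor z) (hor zeta) (hor xi) (ver z).
Proof. by move=> zeta0; rewrite connection_ver.unlock zeta0 vconn0 addr0. Qed.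

Lemma inner_connection2 z e1 e2 e3 e4 : O z ->
  inner GA z (christoffel_form GA z e1 e2) (christoffel_form GA z e3 e4) =
  << conn_hor z e1 e2, conn_hor z e3 e4 >>_(hor z)
  + vinner z (conn_ver z e1 e2) (conn_ver z e3 e4).
Proof.
by move=> Oz; rewrite !(connection_gA _ _ Oz) gA_vinner /conn !hor_lift !vpart_lift.
Qed.

(** The terms from the base reassemble the curvature of g by [inner_curvature]; the vertical terms
    yield the correction. *)
Lemma curvature_hh z v w (xi := hlift_coord G z v) (eta := hlift_coord G z w) : O z ->
  inner GA z (curvature GA z xi eta eta) xi =
  << curvature G (hor z) v w w, v >>_(hor z)
  - 3 / 4 * a (energy G z) *
    << curvature G (hor z) v w (ver z), curvature G (hor z) v w (ver z) >>_(hor z).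
Proof.
move=> Oz.
have xi0 : vpart G z xi = 0 by exact: vpart_hlift.
have eta0 : vpart G z eta = 0 by exact: vpart_hlift.
have hxi : hor xi = v by exact: row_mxKl.
have heta : hor eta = w by exact: row_mxKl.
have diffG r s t : differentiable (fun x => << Gamma x r s, t >>_x) (hor z).
  apply: (smooth_diff U_open) Oz; apply: (smooth_inner G_smooth) => j; last exact: smooth_cst.
  exact: (smooth_christoffel_form U_open G_smooth G_unit).
have T1 : 'D_xi (fun z => inner GA z (christoffel_form GA z eta eta) xi) z =
    'D_v (fun x => << Gamma x w w, v >>_x) (hor z)
    + 2^-1 * (a (energy G z) * Rm (hor z) w v (ver z) (cov xi (fun z => vpart G z eta) z)
      + a (energy G z) * Rm (hor z) w v (ver z) (cov xi (fun z => vpart G z eta) z))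
    + vinner z (conn_field eta eta z) (cov xi (fun z => vpart G z xi) z).
  have D1 := is_derive_lsubmx xi (diffG w w v).
  have D2 := is_derive_riemann_vpart xi w v Oz eta0.
  have D3 := is_derive_vinner_vpart xi Oz (smooth_conn_field eta eta) xi0.
  have := is_derive_add (is_derive_add D1
    (is_derive_mul (is_derive_cst (2^-1 : R) z xi) (is_derive_add D2 D2))) D3.
  rewrite mul0r add0r hxi => -[_ <-]; apply: near_eq_derive.
  apply: (open_near O_open Oz) => z' Oz'.
  by rewrite (inner_connection _ _ _ Oz') hxi heta (conn_fieldE _ _ Oz').
have T2 : 'D_eta (fun z => inner GA z (christoffel_form GA z xi eta) xi) z =
    'D_w (fun x => << Gamma x v w, v >>_x) (hor z)
    + 2^-1 * (a (energy G z) * Rm (hor z) w v (ver z) (cov eta (fun z => vpart G z xi) z))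
    + vinner z (conn_field xi eta z) (cov eta (fun z => vpart G z xi) z).
  have D1 := is_derive_lsubmx eta (diffG v w v).
  have D2 := is_derive_riemann_vpart eta w v Oz xi0.
  have D3 := is_derive_vinner_vpart eta Oz (smooth_conn_field xi eta) xi0.
  have := is_derive_add (is_derive_add D1
    (is_derive_mul (is_derive_cst (2^-1 : R) z eta) D2)) D3.
  rewrite mul0r add0r heta => -[_ <-]; apply: near_eq_derive.
  apply: (open_near O_open Oz) => z' Oz'.
  by rewrite (inner_connection _ _ _ Oz') hxi heta riemann_alt mulr0 add0r (conn_fieldE _ _ Oz').
rewrite (gA_inner_curvature _ _ Oz) T1 T2 !(inner_connection2 _ _ _ _ Oz) {T1 T2}.
rewrite !(conn_fieldE _ _ Oz) (conn_hor_hlift Oz eta0 eta0) (conn_hor_hlift Oz xi0 xi0).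
rewrite (conn_hor_hlift Oz xi0 eta0) (conn_ver_hlift eta eta0) !(conn_ver_hlift _ xi0).
rewrite (inner_curvature U_open G_smooth G_sym G_unit _ _ _ _ Oz).
rewrite (christoffel_formC U_open G_sym w v Oz) hxi heta.
rewrite !(curvature_alt _ _ Oz) scaler0 !addr0.
have RQ q : a (energy G z) * Rm (hor z) w v (ver z) q =
    - vinner z (curvature G (hor z) v w (ver z)) q.
  by rewrite (vinner_curvature _ _ _ Oz) riemann_anti mulrN.
have RR : a (energy G z) *
      << curvature G (hor z) v w (ver z), curvature G (hor z) v w (ver z) >>_(hor z)
    = vinner z (curvature G (hor z) v w (ver z)) (curvature G (hor z) v w (ver z)).
  by rewrite (vinner_curvature _ _ _ Oz) riemann.unlock.
have CV := curvature_vpart xi eta Oz; rewrite hxi heta in CV.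
rewrite !RQ -[3 / 4 * _ * _]mulrA RR {RQ RR}.
(* Let $c$ be the covariant derivative of [vpart G z xi] along [eta] and $r=R_{vw}\mathtt{u}$. The
   vertical component of the connection at [xi], [eta] is $c+r/2$; all terms in $c$ cancel, leaving
   $-|r|^2+|r|^2/4$ in the vertical metric. *)
have -> : cov xi (fun z => vpart G z eta) z = cov eta (fun z => vpart G z xi) z
    + curvature G (hor z) v w (ver z) by rewrite CV addrC subrK.
move: (curvature _ _ _ _ (ver z)) (cov eta (fun z => vpart G z xi) z) => r c {CV}.
move: (cov _ _ _) (cov _ _ _) => c1 c2.
rewrite !(vinnerDl, vinnerZl, vinnerDr _ _ _ Oz, vinnerZr _ _ _ Oz) (vinnerC c r Oz).
move: (vinner _ _ _) (vinner _ _ _) (vinner _ _ _) (vinner _ _ _) => v1 v2 v3 v4.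
move: (inner _ _ _ _) (inner _ _ _ _) (derive _ _ _) (derive _ _ _) => g1 g2 d1 d2.
by field.
Qed.

Lemma curvature_0r (x v w : 'rV[R]_n) : U x -> curvature G x v w 0 = 0.
Proof.
move=> Ux; apply: (inner_nondeg G_unit Ux) => p.
have := riemann_anti_lower v w 0 p Ux; rewrite riemann.unlock => ->.
by rewrite inner0r oppr0.
Qed.

Lemma hor_vlift v : hor (vlift_coord v) = 0.
Proof. exact: row_mxKl. Qed.

Lemma vpart_vlift_cst w : (fun z => vpart G z (vlift_coord w)) = (fun=> w).
Proof. by apply/funext => z; exact: vpart_vlift. Qed.

Lemma conn_hor_vlift z v w : O z -> conn_hor z (vlift_coord v) (vlift_coord w) = 0.
Proof.
move=> Oz; rewrite connection_hor.unlock !hor_vlift !(curvature_0r _ _ Oz).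
by rewrite christoffel_form_0l addr0 scaler0 addr0.
Qed.

Lemma conn_ver_vlift z v w : O z -> conn_ver z (vlift_coord v) (vlift_coord w) = vconn z v w.
Proof.
move=> Oz; rewrite connection_ver.unlock vpart_vlift_cst cov_cst !hor_vlift.
by rewrite (curvature0 _ _ Oz) christoffel_form_0l !vpart_vlift scaler0 !add0r.
Qed.

(** All vertical terms cancel in pairs: the curvature term between [cov xi] of [vpart eta] and
    [cov eta] of [vpart xi] vanishes, since [eta] has no horizontal part. What remains is the
    squared norm of the horizontal component of the connection at [xi], [eta]. *)
Lemma curvature_hv z v w (xi := hlift_coord G z v) (eta := vlift_coord w) : O z ->
  inner GA z (curvature GA z xi eta eta) xi =
  a (energy G z) ^+ 2 / 4 *
  << curvature G (hor z) (ver z) w v, curvature G (hor z) (ver z) w v >>_(hor z).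
Proof.
move=> Oz.
have xi0 : vpart G z xi = 0 by exact: vpart_hlift.
have hxi : hor xi = v by exact: row_mxKl.
have heta : hor eta = 0 by exact: hor_vlift.
have T1 : 'D_xi (fun z => inner GA z (christoffel_form GA z eta eta) xi) z =
    vinner z (conn_field eta eta z) (cov xi (fun z => vpart G z xi) z).
  have [_ <-] := is_derive_vinner_vpart xi Oz (smooth_conn_field eta eta) xi0.
  apply: near_eq_derive; apply: (open_near O_open Oz) => z' Oz'.
  rewrite (inner_connection _ _ _ Oz') heta christoffel_form_0l inner0l.
  by rewrite !(riemann0 _ _ _ Oz') !mulr0 addr0 mulr0 !add0r (conn_fieldE _ _ Oz').
have T2 : 'D_eta (fun z => inner GA z (christoffel_form GA z xi eta) xi) z =
    vinner z (conn_field xi eta z) (cov eta (fun z => vpart G z xi) z).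
  have [_ <-] := is_derive_vinner_vpart eta Oz (smooth_conn_field xi eta) xi0.
  apply: near_eq_derive; apply: (open_near O_open Oz) => z' Oz'.
  rewrite (inner_connection _ _ _ Oz') heta hxi christoffel_form_0r inner0l riemann_alt.
  by rewrite !(riemann0 _ _ _ Oz') !mulr0 addr0 mulr0 !add0r (conn_fieldE _ _ Oz').
rewrite (gA_inner_curvature _ _ Oz) T1 T2 !(inner_connection2 _ _ _ _ Oz) {T1 T2}.
rewrite !(conn_fieldE _ _ Oz) !(conn_ver_hlift _ xi0) (conn_hor_vlift _ _ Oz) hxi heta.
rewrite (curvature_alt _ _ Oz) (curvature0 _ _ Oz) scaler0 !addr0 inner0l add0r.
have CV := curvature_vpart xi eta Oz; rewrite hxi heta (curvature0 _ _ Oz) in CV.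
have -> : cov xi (fun z => vpart G z eta) z = cov eta (fun z => vpart G z xi) z.
  by apply/eqP; rewrite -subr_eq0 -CV.
have -> : conn_hor z xi eta = (a (energy G z) / 2) *: curvature G (hor z) (ver z) w v.
  rewrite connection_hor.unlock hxi heta xi0 (vpart_vlift G z w) christoffel_form_0r.
  by rewrite (curvature_0r _ _ Oz) add0r addr0.
move: (curvature _ _ _ _ _) (cov _ _ _) (cov _ _ _) (conn_ver _ _ _) => r c1 c2 c3 {CV}.
rewrite innerZl innerZr.
by move: (vinner _ _ _) (vinner _ _ _) (inner _ _ _ _) (a _) => *; field.
Qed.

Lemma vinner_vconn z v1 v2 v3 : O z -> vinner z (vconn z v1 v2) v3 =
  let g := inner G (hor z) in let y := ver z in let t := energy G z in
  a t * (fL a t * (g v1 y * g v2 v3 + g v2 y * g v1 v3)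
         + (fM a b t * g v1 v2 + fN a b t * g v1 y * g v2 y) * g v3 y)
  + b t * (fL a t * (g v1 y * g v2 y + g v2 y * g v1 y)
           + (fM a b t * g v1 v2 + fN a b t * g v1 y * g v2 y) * (2 * t)) * g v3 y.
Proof. by move=> Oz /=; rewrite vertical_metric.unlock !(inner_vconn _ _ _ Oz) inner_ver. Qed.

Lemma is_derive_vlift_inner z p v w : O z ->
  is_derive z (vlift_coord p) (fun z => << v, w >>_(hor z)) 0.
Proof.
move=> Oz; apply: is_derive_eq (is_derive_inner (vlift_coord p) Oz
  (smooth_field_cst O v) (smooth_field_cst O w)) _.
by rewrite !cov_cst hor_vlift !christoffel_form_0l inner0l inner0r addr0.
Qed.

Lemma is_derive_vlift_inner_ver z p v : O z ->
  is_derive z (vlift_coord p) (fun z => << v, ver z >>_(hor z)) << v, p >>_(hor z).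
Proof.
move=> Oz; apply: is_derive_eq (is_derive_inner (vlift_coord p) Oz
  (smooth_field_cst O v) smooth_field_ver) _.
by rewrite cov_cst cov_ver vpart_vlift hor_vlift christoffel_form_0l inner0l add0r.
Qed.

(** Along a vertical direction the base point is fixed, so only $t$ and the products with
    $\mathtt{u}$ vary; [q'] is the derivative of the coefficient [q] of $\mathtt{u}$ in
    [vertical_connection]. *)
Lemma derive_vinner_vconn z p v1 v2 v3 : O z ->
  let g := inner G (hor z) in let y := ver z in let t := energy G z in
  let q := fM a b t * g v1 v2 + fN a b t * g v1 y * g v2 y in
  let q' := hl_derive (fM a b) t * g p y * g v1 v2
    + hl_derive (fN a b) t * g p y * g v1 y * g v2 y
    + fN a b t * g v1 p * g v2 y + fN a b t * g v1 y * g v2 p in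
  'D_(vlift_coord p) (fun z => vinner z (vconn z v1 v2) v3) z =
  hl_derive a t * g p y * (fL a t * (g v1 y * g v2 v3 + g v2 y * g v1 v3) + q * g v3 y)
  + a t * (hl_derive (fL a) t * g p y * (g v1 y * g v2 v3 + g v2 y * g v1 v3)
      + fL a t * (g v1 p * g v2 v3 + g v2 p * g v1 v3) + q' * g v3 y + q * g v3 p)
  + hl_derive b t * g p y * (2 * fL a t * g v1 y * g v2 y + q * (2 * t)) * g v3 y
  + b t * (2 * hl_derive (fL a) t * g p y * g v1 y * g v2 y
      + 2 * fL a t * (g v1 p * g v2 y + g v1 y * g v2 p)
      + q' * (2 * t) + q * (2 * g p y)) * g v3 y
  + b t * (2 * fL a t * g v1 y * g v2 y + q * (2 * t)) * g v3 p.
Proof.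
move=> Oz g y t q q'; have t0 := energy_ge0 Oz.
have dS v := is_derive_vlift_inner_ver p v Oz.
have dC v w := is_derive_vlift_inner p v w Oz.
have E : << vpart G z (vlift_coord p), ver z >>_(hor z) = << p, ver z >>_(hor z).
  by rewrite vpart_vlift.
have dE := is_derive_energy (vlift_coord p) Oz.
have dphi phi := @is_derive_hl_energy phi (vlift_coord p) z Oz.
have dA := dphi _ (hl_smooth_cvg a_smooth t0).
have dB := dphi _ (hl_smooth_cvg b_smooth t0).
have dL := dphi _ (fL_cvg a_smooth a_gt0 t0).
have dM := dphi _ (fM_cvg a_smooth b_smooth a_gt0 b_ge0 t0).
have dN := dphi _ (fN_cvg a_smooth b_smooth a_gt0 b_ge0 t0).
rewrite !E {dphi} in dA dB dL dM dN dE.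
have dQ := is_derive_add (is_derive_mul dM (dC v1 v2))
  (is_derive_mul (is_derive_mul dN (dS v1)) (dS v2)).
have d1 := is_derive_add
  (is_derive_mul dL (is_derive_add (is_derive_mul (dS v1) (dC v2 v3))
    (is_derive_mul (dS v2) (dC v1 v3)))) (is_derive_mul dQ (dS v3)).
have d2 := is_derive_add
  (is_derive_mul dL (is_derive_add (is_derive_mul (dS v1) (dS v2))
    (is_derive_mul (dS v2) (dS v1))))
  (is_derive_mul dQ (is_derive_mul (is_derive_cst (2 : R) z _) dE)).
have D := is_derive_add (is_derive_mul dA d1) (is_derive_mul (is_derive_mul dB d2) (dS v3)).
have near_z := open_near O_open Oz (fun z' Oz' => esym (vinner_vconn v1 v2 v3 Oz')).
have [_ ->] := near_eq_is_derive near_z D.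
rewrite /q' /q /g /y /t /cst {dA dB dL dM dN dE dQ d1 d2 dS dC E D near_z q q' g y t t0}.
move: (energy G z) => t.
move: (hl_derive _ _) (hl_derive _ _) (hl_derive _ _) => x1 x2 x3.
move: (hl_derive _ _) (hl_derive _ _) => x4 x5.
move: (a t) (b t) (fL a t) (fM a b t) (fN a b t) => A B L M N.
move: (inner _ _ _ _) (inner _ _ _ _) (inner _ _ _ _) (inner _ _ _ _) => y1 y2 y3 y4.
move: (inner _ _ _ _) (inner _ _ _ _) (inner _ _ _ _) (inner _ _ _ _) => y5 y6 y7 y8.
by move: (inner _ _ _ _) (inner _ _ _ _) => y9 y10; ring.
Qed.

(** Vertical lifts of constant vectors have constant vertical part and no horizontal part, so the
    connection reduces to [vconn] and the claim to an identity between rational functions of the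
    coefficients and their derivatives. *)
Lemma curvature_vv z v w (xi := vlift_coord v) (eta := vlift_coord w)
    (t := energy G z) (r := << v, ver z >>_(hor z)) (s := << w, ver z >>_(hor z)) : O z ->
    << v, v >>_(hor z) = 1 -> << w, w >>_(hor z) = 1 -> << v, w >>_(hor z) = 0 ->
  inner GA z (curvature GA z xi eta eta) xi =
  - (F1 a b t * a t * s ^+ 2 + F2 a b t * (a t + b t * r ^+ 2)
     + F3 a b t * (a t + 2 * t * b t) * r ^+ 2).
Proof.
move=> Oz vv ww vw; have t0 : 0 <= t := energy_ge0 Oz.
have wv : << w, v >>_(hor z) = 0 by rewrite (innerC G_sym w v Oz).
have K (e1 e2 e3 : 'rV[R]_n) :
    'D_(vlift_coord e3) (fun z => inner GA z
      (christoffel_form GA z (vlift_coord e1) (vlift_coord e2)) xi) z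
    = 'D_(vlift_coord e3) (fun z => vinner z (vconn z e1 e2) v) z.
  apply: near_eq_derive; apply: (open_near O_open Oz) => z' Oz'.
  rewrite (connection_gA _ _ Oz') gA_vinner /conn hor_lift vpart_lift hor_vlift inner0r add0r.
  by rewrite vpart_vlift (conn_ver_vlift _ _ Oz').
rewrite (gA_inner_curvature _ _ Oz) !K !(inner_connection2 _ _ _ _ Oz) {K}.
rewrite !(conn_hor_vlift _ _ Oz) !(conn_ver_vlift _ _ Oz) !inner0l.
rewrite !(derive_vinner_vconn _ _ _ _ Oz) !(vinner_vconn _ _ _ Oz) /=.
rewrite !(innerC G_sym _ (vconn _ _ _) Oz) !(inner_vconn _ _ _ Oz) !inner_ver.
rewrite vv ww vw wv -/r -/s -/t /F1 /F2 /F3.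
rewrite (hl_derive_fL a_gt0 t0) (hl_derive_fN a_gt0 b_ge0 t0).
have := fM_relation a_gt0 b_ge0 t0; have := a_neq0 a_gt0 t0.
move: (hl_derive _ _) (hl_derive _ _) (hl_derive _ _) => x1 x2 x3.
move: r s t t0 => r s t t0.
move: (a t) (b t) (fL a t) (fM a b t) (fN a b t) => A B L M N A0 H.
(* Eliminating L by [fM_relation] removes the only relation between the unknowns; the rest is an
   identity of rational functions with denominators powers of [A]. *)
have -> : L = (B - M * (A + 2 * t * B)) / A by rewrite {1}H; field.
by field.
Qed.

End TangentBundle.

(** * The three sectional curvatures *)

Lemma tnorm_sqr (R : realType) (n : nat) (M : manifold R n) (g : riemannian_metric M)
    (i : chart M) (p : M) (X : components M) : dom i p ->
  tnorm g i p X ^+ 2 = dot g i p X X.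
Proof.
move=> pi; rewrite sqr_sqrtr // /dot; have [->|v0] := eqVneq (X i) 0.
  by rewrite inner0l.
by rewrite ltW // (Defs.metric_pos (riemannianP g)).
Qed.

Theorem proposition2p15 (R : realType) (n : nat) (M : manifold R n)
  (g : riemannian_metric M) (a b : R -> R)
  (a_smooth : hl_smooth a) (b_smooth : hl_smooth b)
  (a_gt0 : forall t : R, 0 <= t -> 0 < a t)
  (b_ge0 : forall t : R, 0 <= t -> 0 <= b t)
  (p : M) (u X Y : tangent p) (i : chart M) (p_in_i : dom i p)
  (X_unit : dot g i p X X = 1) (Y_unit : dot g i p Y Y = 1)
  (XY_orth : dot g i p X Y = 0) :
  let TM := tangent_bundle M in
  let q : TM := existT _ p u in
  let XH := hlift g q X in
  let YH := hlift g q Y in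
  let XV := vlift X in
  let YV := vlift Y in
  let K := sectional_curvature g i p in
  let KA := sectional_curvature (A := TM) (gA a b g) i q in
  let t : R := 2^-1 * dot g i p u u in
  let gXu := dot g i p X u in
  let gYu := dot g i p Y u in
  [/\ KA XH YH = K X Y
        - 3 * a t / 4 * tnorm g i p (curvature_tensor g p X Y u) ^+ 2,
      KA XH YV = a t ^+ 2 / (4 * (a t + b t * gYu ^+ 2))
        * tnorm g i p (curvature_tensor g p u Y X) ^+ 2
    & KA XV YV =
        - ((F1 a b t * a t * gYu ^+ 2 + F2 a b t * (a t + b t * gXu ^+ 2)
            + F3 a b t * (a t + 2 * t * b t) * gXu ^+ 2)
           / (a t ^+ 2 + a t * b t * (gXu ^+ 2 + gYu ^+ 2)))].
Proof.
move=> TM q XH YH XV YV K KA t gXu gYu.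
pose U : set 'rV[R]_n := Defs.coord i @` dom i.
have Up : U (Defs.coord i p) by exists p.
have U_open : open U := @coord_dom_open _ _ _ (manifoldP M) i.
have G_smooth k l : smooth U (fun x => metric_gram g i x k l).
  exact: smooth_entry (@Defs.metric_smooth _ _ _ _ (riemannianP g) i).
have G_sym x : U x -> (metric_gram g i x)^T = metric_gram g i x.
  by move=> [p' p'i <-]; exact: (Defs.metric_sym (riemannianP g) p'i).
have G_pos x : U x -> forall v, v != 0 -> 0 < inner (metric_gram g i) x v v.
  by move=> [p' p'i <-]; exact: (Defs.metric_pos (riemannianP g) p'i).
pose x := tangent_components X i; pose w := tangent_components Y i.
pose y := tangent_components u i.
(* The point $(p,\mathtt{u})$ in the induced chart, where the three curvature formulas apply. *)
pose z : 'rV[R]_(n + n) := row_mx (Defs.coord i p) y.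
have hz : lsubmx z = Defs.coord i p by exact: row_mxKl.
have vz : rsubmx z = y by exact: row_mxKr.
have Oz : U (lsubmx z) by rewrite hz.
have tE : energy (metric_gram g i) z = t by rewrite /energy hz vz.
have HH := curvature_hh U_open G_smooth G_sym G_pos a_smooth b_smooth a_gt0 b_ge0.
have HV := curvature_hv U_open G_smooth G_sym G_pos a_smooth b_smooth a_gt0 b_ge0.
have VV := curvature_vv U_open G_smooth G_sym G_pos a_smooth b_smooth a_gt0 b_ge0.
have gHH := gA_hlift_hlift a b (metric_gram g i) z.
have gHV := gA_hlift_vlift a b (metric_gram g i) z.
have gVV := gA_vlift_vlift a b (metric_gram g i) z.
have xx : inner (metric_gram g i) (lsubmx z) x x = 1 by rewrite hz; exact: X_unit.
have ww : inner (metric_gram g i) (lsubmx z) w w = 1 by rewrite hz; exact: Y_unit.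
have xw : inner (metric_gram g i) (lsubmx z) x w = 0 by rewrite hz; exact: XY_orth.
have wx : inner (metric_gram g i) (lsubmx z) w x = 0 by rewrite (innerC G_sym _ _ Oz).
have xy : inner (metric_gram g i) (lsubmx z) x (rsubmx z) = gXu by rewrite hz vz.
have wy : inner (metric_gram g i) (lsubmx z) w (rsubmx z) = gYu by rewrite hz vz.
have t0 : 0 <= t by rewrite -tE; exact: (energy_ge0 G_pos).
have a0 := a_gt0 _ t0; have b0 := b_ge0 _ t0.
rewrite !(tnorm_sqr _ _ p_in_i).
have -> : KA XH YH = sectional (gA_gram a b (metric_gram g i)) z
    (hlift_coord (metric_gram g i) z x) (hlift_coord (metric_gram g i) z w) by [].
have -> : KA XH YV = sectional (gA_gram a b (metric_gram g i)) z
    (hlift_coord (metric_gram g i) z x) (vlift_coord w) by [].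
have -> : KA XV YV = sectional (gA_gram a b (metric_gram g i)) z
    (vlift_coord x) (vlift_coord w) by [].
have -> : K X Y = sectional (metric_gram g i) (lsubmx z) x w by rewrite hz.
have -> : dot g i p (curvature_tensor g p X Y u) (curvature_tensor g p X Y u) =
    inner (metric_gram g i) (lsubmx z) (curvature (metric_gram g i) (lsubmx z) x w (rsubmx z))
      (curvature (metric_gram g i) (lsubmx z) x w (rsubmx z)) by rewrite hz vz.
have -> : dot g i p (curvature_tensor g p u Y X) (curvature_tensor g p u Y X) =
    inner (metric_gram g i) (lsubmx z) (curvature (metric_gram g i) (lsubmx z) (rsubmx z) w x)
      (curvature (metric_gram g i) (lsubmx z) (rsubmx z) w x) by rewrite hz vz.
(* Numerators come from the curvature formulas, denominators from the Gram determinants of the three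
   pairs of lifts computed next. *)
have div (c c' d d' : R) : c = c' -> d = d' -> c / d = c' / d' by move=> -> ->.
have dHH : inner (gA_gram a b (metric_gram g i)) z (hlift_coord (metric_gram g i) z x)
      (hlift_coord (metric_gram g i) z x)
    * inner (gA_gram a b (metric_gram g i)) z (hlift_coord (metric_gram g i) z w)
      (hlift_coord (metric_gram g i) z w)
    - inner (gA_gram a b (metric_gram g i)) z (hlift_coord (metric_gram g i) z x)
      (hlift_coord (metric_gram g i) z w) ^+ 2 = 1.
  by rewrite !gHH xx ww xw mul1r expr0n subr0.
have dHV : inner (gA_gram a b (metric_gram g i)) z (hlift_coord (metric_gram g i) z x)
      (hlift_coord (metric_gram g i) z x)
    * inner (gA_gram a b (metric_gram g i)) z (vlift_coord w) (vlift_coord w)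
    - inner (gA_gram a b (metric_gram g i)) z (hlift_coord (metric_gram g i) z x)
      (vlift_coord w) ^+ 2 = a t + b t * gYu ^+ 2.
  by rewrite gHH gHV gVV xx ww wy tE mul1r mulr1 expr0n subr0 -mulrA -expr2.
(* Orthonormality reduces this to $(a+br^2)(a+bs^2)-b^2r^2s^2$ with $r=g(X,\mathtt{u})$ and
   $s=g(Y,\mathtt{u})$, whose quartic terms cancel. *)
have dVV : inner (gA_gram a b (metric_gram g i)) z (vlift_coord x) (vlift_coord x)
    * inner (gA_gram a b (metric_gram g i)) z (vlift_coord w) (vlift_coord w)
    - inner (gA_gram a b (metric_gram g i)) z (vlift_coord x) (vlift_coord w) ^+ 2
    = a t ^+ 2 + a t * b t * (gXu ^+ 2 + gYu ^+ 2).
  by rewrite !gVV xx ww xw xy wy tE; ring.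
split.
- rewrite [LHS](div _ _ _ _ (HH _ _ _ Oz) dHH) tE /sectional xx ww xw.
  rewrite mul1r expr0n subr0 !divr1.
  by move: (inner _ _ _ _) (inner _ _ _ _) (a t) => c1 c2 c3; field.
- rewrite [LHS](div _ _ _ _ (HV _ _ _ Oz) dHV) tE.
  move: (inner _ _ _ _) => c; field.
  by rewrite gt_eqF // ltr_wpDr // mulr_ge0 // sqr_ge0.
- by rewrite [LHS](div _ _ _ _ (VV _ _ _ Oz xx ww xw) dVV) xy wy tE mulNr.
Qed.
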